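(* For every constant $\epsilon>0$ there exists an algorithm for the submodular matroid secretary problem with shortlists that achieves a competitive ratio of $\frac{1}{2}\left(1-\frac{1}{e^2}-\epsilon\right)$ using a shortlist of size $\tilde{O}\left(\frac{k}{\epsilon}\right)$. The running time of this algorithm is $O(nk)$.
   Context: Submodular matroid secretary problem with shortlists: a matroid $\mathcal{M}=(\mathcal{N},\mathcal{I})$ of rank $k=rk(\mathcal{M})$ is given, with the algorithm having access to an independence oracle (deciding whether a set is in $\mathcal{I}$). A set $\mathcal{U}=\{a_1,\dots,a_n\}$ of items (elements of the matroid) is fixed in advance but unknown to the algorithm; only $n$ is known. The items arrive one at a time over $n$ rounds in a uniformly random order. When an item arrives, the algorithm must irrevocably decide whether to add it to a shortlist $A$. The objective is a nonnegative monotone submodular function $f$ accessible through a value oracle. The algorithm's value is $\mathrm{ALG}=\mathbb{E}[\max_{S\subseteq A,\, S\in\mathcal{I}} f(S)]$, and $\mathrm{OPT}=\max_{S\subseteq\mathcal{U},\,S\in\mathcal{I}} f(S)$. An algorithm achieves competitive ratio $c$ with shortlist of size $\eta(k)$ if at the end $|A|\le\eta(k)$ and $\mathrm{ALG}/\mathrm{OPT}\ge c$. The $\tilde{O}$ notation hides polylogarithmic factors in $1/\epsilon$. *)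

(* Defs.v *)
From HB Require Import structures.
From mathcomp Require Import all_boot all_order all_algebra.
From mathcomp Require Import reals.

Set Implicit Arguments.
Unset Strict Implicit.
Unset Printing Implicit Defensive.

Import Order.TTheory GRing.Theory Num.Theory.
Local Open Scope ring_scope.

(** * Matroids and submodular functions *)

Record matroid (E : finType) := Matroid {
  indep :> {set E} -> bool;
  indep0 : indep set0;
  indepS : forall A B : {set E}, A \subset B -> indep B -> indep A;
  indep_aug : forall A B : {set E}, indep A -> indep B -> (#|A| < #|B|)%N ->
    exists2 x, x \in B :\: A & indep (x |: A) }.

Definition rank (E : finType) (M : matroid E) : nat :=
  \max_(S : {set E} | M S) #|S|.

Definition nonnegative (R : realType) (E : finType) (f : {set E} -> R) : Prop :=
  forall A, 0 <= f A.

Definition monotone (R : realType) (E : finType) (f : {set E} -> R) : Prop :=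
  forall A B : {set E}, A \subset B -> f A <= f B.

Definition submodular (R : realType) (E : finType) (f : {set E} -> R) : Prop :=
  forall A B : {set E}, f (A :|: B) + f (A :&: B) <= f A + f B.

(* The default value 0 is harmless: [set0] is always feasible and the objective
   is nonnegative. *)
Definition best_value (R : realType) (E : finType) (M : matroid E)
    (f : {set E} -> R) (A : {set E}) : R :=
  \big[Order.max/0]_(S : {set E} | (S \subset A) && M S) f S.

(** * Online randomized oracle algorithms

  Algorithms are programs for a unit-cost random-access machine with an integer
  memory and a real memory, both indirectly addressable.  Programs contain only
  integer literals, so that every one of them is a finite object, independent of
  the instance.  As usual, integers support + and truncated -, but not unit-cost
  multiplication, and reals support field operations and comparisons, but not
  rounding to an integer.

  Items are opaque: the program names an item by its arrival index (0 for the
  first arrival) and learns about items only through the two oracles, which it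
  can query only on sets of items that have already arrived. *)

Inductive nexp :=
  | NConst of nat
  | NLoad of nexp
  | NAdd of nexp & nexp
  | NSub of nexp & nexp.

Inductive rexp :=
  | RNat of nexp
  | RLoad of nexp
  | RAdd of rexp & rexp
  | RSub of rexp & rexp
  | RMul of rexp & rexp
  | RDiv of rexp & rexp.

Inductive bexp :=
  | BLeN of nexp & nexp
  | BLeR of rexp & rexp
  | BNot of bexp
  | BAnd of bexp & bexp.

(* - [SetN a e], [SetR a e] write e at address a of the integer or real memory;
   - [Rand a e] writes at a a fresh uniform random element of {0, ..., e};
   - [Indep a p l] and [Value a p l] query an oracle on the set of the items
     whose arrival indices are stored in the l integer cells p, ..., p + l - 1;
     the answer goes to the integer cell a (as 0 or 1), resp. the real cell a;
   - [Receive] ends the current round and reveals the next item, if any;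
   - [Accept] puts the item of the current round in the shortlist. *)
Inductive instr :=
  | SetN of nexp & nexp
  | SetR of nexp & rexp
  | Rand of nexp & nexp
  | Indep of nexp & nexp & nexp
  | Value of nexp & nexp & nexp
  | Receive
  | Accept
  | If of bexp & seq instr & seq instr
  | While of bexp & seq instr.

Definition program := seq instr.

Record config (R : realType) (E : finType) := Config {
  code : program;
  nmem : nat -> nat;
  rmem : nat -> R;
  arrived : seq E;
  pending : seq E;
  shortlist : {set E} }.

Definition upd (T : Type) (m : nat -> T) (a : nat) (v : T) : nat -> T :=
  fun b => if b == a then v else m b.

Fixpoint neval (m : nat -> nat) (e : nexp) : nat :=
  match e with
  | NConst c => c
  | NLoad a => m (neval m a)
  | NAdd e1 e2 => (neval m e1 + neval m e2)%N
  | NSub e1 e2 => (neval m e1 - neval m e2)%N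
  end.

Fixpoint reval (R : realType) (m : nat -> nat) (r : nat -> R) (e : rexp) : R :=
  match e with
  | RNat a => (neval m a)%:R
  | RLoad a => r (neval m a)
  | RAdd e1 e2 => reval m r e1 + reval m r e2
  | RSub e1 e2 => reval m r e1 - reval m r e2
  | RMul e1 e2 => reval m r e1 * reval m r e2
  | RDiv e1 e2 => reval m r e1 / reval m r e2
  end.

Fixpoint beval (R : realType) (m : nat -> nat) (r : nat -> R) (b : bexp) : bool :=
  match b with
  | BLeN e1 e2 => (neval m e1 <= neval m e2)%N
  | BLeR e1 e2 => reval m r e1 <= reval m r e2
  | BNot b1 => ~~ beval m r b1
  | BAnd b1 b2 => beval m r b1 && beval m r b2
  end.

(* Indices of items that have not arrived yet are ignored. *)
Definition query_set (E : finType) (arr : seq E) (m : nat -> nat) (p l : nat) :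
    {set E} :=
  [set x in pmap (fun j => onth arr (m j)) (iota p l)].

(* The equally likely successors of a configuration; there is exactly one unless
   the next instruction is [Rand], and none once the program has halted. *)
Definition step (R : realType) (E : finType) (M : matroid E) (f : {set E} -> R)
    (c : config R E) : seq (config R E) :=
  let: Config code m r arr pend A := c in
  if code is i :: K then
    match i with
    | SetN a e => [:: Config K (upd m (neval m a) (neval m e)) r arr pend A]
    | SetR a e => [:: Config K m (upd r (neval m a) (reval m r e)) arr pend A]
    | Rand a e => [seq Config K (upd m (neval m a) j) r arr pend A
                  | j <- iota 0 (neval m e).+1]
    | Indep a p l =>
        let S := query_set arr m (neval m p) (neval m l) in
        [:: Config K (upd m (neval m a) (M S : nat)) r arr pend A]
    | Value a p l =>
        let S := query_set arr m (neval m p) (neval m l) in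
        [:: Config K m (upd r (neval m a) (f S)) arr pend A]
    | Receive =>
        [:: if pend is x :: pend' then Config K m r (rcons arr x) pend' A
            else Config K m r arr pend A]
    | Accept =>
        [:: if arr is x :: arr' then Config K m r arr pend (last x arr' |: A)
            else Config K m r arr pend A]
    | If b c1 c2 =>
        [:: Config ((if beval m r b then c1 else c2) ++ K) m r arr pend A]
    | While b c1 =>
        [:: Config (if beval m r b then c1 ++ code else K) m r arr pend A]
    end
  else [::].

Definition halted (R : realType) (E : finType) (c : config R E) : bool :=
  nilp (code c).

(* Integer cells 0 and 1 initially hold the number of items and the rank. *)
Definition start (R : realType) (E : finType) (M : matroid E) (p : program)
    (s : seq E) : config R E :=
  Config p (fun a => nth 0%N [:: size s; rank M] a) (fun=> 0) [::] s set0.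

(* Whatever the random choices, the run halts after at most T steps, in a
   configuration that satisfies P. *)
Fixpoint always (R : realType) (E : finType) (M : matroid E) (f : {set E} -> R)
    (T : nat) (P : config R E -> bool) (c : config R E) : bool :=
  if halted c then P c
  else if T is T'.+1 then all (always M f T' P) (step M f c) else false.

(* The expectation of g at the end of the run, for runs of at most T steps. *)
Fixpoint expected (R : realType) (E : finType) (M : matroid E) (f : {set E} -> R)
    (T : nat) (g : config R E -> R) (c : config R E) : R :=
  if halted c then g c
  else if T is T'.+1 then
    (size (step M f c))%:R^-1 * \sum_(c' <- step M f c) expected M f T' g c'
  else 0.

(** * The submodular matroid secretary problem with shortlists *)

(* The items arrive in uniformly random order, independent of the coins of the
   program. *)
Definition ALG (R : realType) (E : finType) (M : matroid E) (f : {set E} -> R)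
    (U : {set E}) (p : program) (T : nat) : R :=
  (size (permutations (enum U)))%:R^-1 *
  \sum_(s <- permutations (enum U))
    expected M f T (fun c => best_value M f (shortlist c)) (start R M p s).

Definition OPT (R : realType) (E : finType) (M : matroid E) (f : {set E} -> R)
    (U : {set E}) : R := best_value M f U.

(* On every instance, p runs in time at most [tau n k], ends with a shortlist of
   size at most [eta k], and is c-competitive. *)
Definition achieves (R : realType) (p : program) (c : R) (eta : nat -> R)
    (tau : nat -> nat -> nat) : Prop :=
  forall (E : finType) (M : matroid E) (f : {set E} -> R) (U : {set E}),
    nonnegative f -> monotone f -> submodular f ->
    let n := #|U| in
    let k := rank M in
    (forall s, s \in permutations (enum U) ->
       always M f (tau n k) (fun c' => #|shortlist c'|%:R <= eta k)
         (start R M p s)) /\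
    c * OPT M f U <= ALG M f U p (tau n k).

(* Main.v *)
Require Import Defs.
From mathcomp Require Import all_boot all_order all_algebra.
From mathcomp Require Import reals sequences exp.
From mathcomp Require Import zify ring lra.
Import Order.TTheory GRing.Theory Num.Theory.
Set Implicit Arguments.
Unset Strict Implicit.
Unset Printing Implicit Defensive.
Local Open Scope ring_scope.

(** Let [k] be the smaller of the rank and the number of items.  The program cuts the
    random order into [W = Q k] windows, which distributes the items over the windows
    like a uniform map [phi], and maintains an independent set [S].  In each window it
    makes the best feasible swap of one item of the window into [S], or of one formerly
    selected item, picked at random.

    Moving an item that was never selected from an earlier window to window [w] does not
    change the state before [w]; hence, given this state, such an item of an optimal set
    [O] is in window [w] with probability at least [1 / W].  Since [W] is much larger
    than [k], the expected gain of a window is nearly [1 / W] times the sum of the gains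
    of all swaps of elements of [O] into [S], and by the exchange property this sum is at
    least [f O - 2 f S].  After [W] windows this gives [f S >= (1 - e^-2 - O(1/Q)) f O / 2]
    in expectation.

    [S] may contain items that were not put in the shortlist.  In a window of [m] items
    the program accepts the records that come after the first [m / B] items, up to [L] of
    them.  In a random order the best item of a window is accepted with probability
    [1 - O(1/B)] if [L] is about [2 log2 B], so submodularity bounds the loss.  Random
    keys break ties: they make [S] independent of the order inside the windows. *)

(** * Matroid exchange and submodularity *)

(** The obstacle is an item of [O] that was selected before: the history reveals its window, so its
    place is no longer random, although it may have been swapped out and be worth swapping in again.
    Rechecking the selection of an index drawn uniformly among all [W] repairs this: each former
    selection is offered again with probability at least [1 / W], the same rate as for a fresh item,
    so both kinds of items enter one recurrence. Swaps are decided at the end of a window,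
    acceptances on arrival. The swapped set is therefore analysed as if every item stayed available,
    and is intersected with the shortlist only at the very end. Since the swapped set does not
    depend on the order inside the windows, that order is averaged last, with the set held fixed,
    and each of its items is the winner of some window. *)

Lemma card_setD1 (E : finType) (A : {set E}) x d : x \in A -> #|A| = d.+1 -> #|A :\ x| = d.
Proof. by rewrite (cardsD1 x A) => -> []. Qed.

Section MatroidExchange.
Variables (E : finType) (M : matroid E).
Implicit Types (S O A B : {set E}).

Lemma indep_extend A B : M A -> M B -> (#|A| <= #|B|)%N ->
  exists C : {set E}, [/\ A \subset C, C \subset A :|: B, M C & #|C| = #|B|].
Proof.
move: {2}(#|B| - #|A|)%N (erefl (#|B| - #|A|)%N) => d.
elim: d A => [|d IH] A Ed iA iB leAB.
  by exists A; split; rewrite ?subxx ?subsetUl //; lia.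
have ltAB : (#|A| < #|B|)%N by lia.
have [x /setDP[xB xA] iAx] := indep_aug iA iB ltAB.
have cAx : #|x |: A| = #|A|.+1 by rewrite cardsU1 xA.
case: (IH (x |: A)) => // [| |C [sC1 sC2 iC cC]]; try (rewrite cAx; lia).
exists C; split=> //; first exact: subset_trans (subsetUr _ _) sC1.
apply: subset_trans sC2 _; apply/subsetP=> y; rewrite !inE => /orP[/orP[/eqP->|->]|->] //.
  by rewrite xB orbT.
by rewrite orbT.
Qed.

(** The set [Z] is the fundamental circuit of [o] in [S], without [o]. If no [c] of [Z :\: O] could
    replace [o] in [O], then [O :\ o] would span [Z]; extending [Z] to the size of [O :\ o] inside
    their union would give a set that [O] cannot augment. *)
Lemma symmetric_exchange S O o : M S -> M O -> o \in O -> o \notin S ->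
  ~~ M (o |: S) ->
  exists c, [/\ c \in S :\: O, M (o |: S :\ c) & M (c |: O :\ o)].
Proof.
move=> iS iO oO oS dS.
pose Z := [set c in S | M (o |: S :\ c)].
have sZS : Z \subset S by apply/subsetP=> c; rewrite inE => /andP[].
have dZ : ~~ M (o |: Z).
  apply/negP=> iZ.
  have neZS : Z != S by apply/eqP=> ZS; move: dS; rewrite -ZS iZ.
  have ltZS : (#|Z| < #|S|)%N by rewrite proper_card // properEneq neZS.
  have oZ : o \notin Z by apply: contra oS; apply/subsetP.
  case: (indep_extend iZ iS); first by rewrite cardsU1 oZ.
  move=> C [sZC sC iC cC].
  (* [C] has the size of [S] and contains [o], so it misses some [c] of [S]. Then [C] is
     [o |: S :\ c], which puts [c] in [Z], hence in [C]. *)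
  have /subsetPn[c cS cC'] : ~~ (S \subset C).
    apply/negP => sSC.
    have : o |: S \subset C by rewrite subUset sSC andbT sub1set (subsetP sZC) // setU11.
    by move/subset_leq_card; rewrite cardsU1 oS cC ltnn.
  have cZ : c \notin Z by apply: contra cC' => cZ; apply: (subsetP sZC); rewrite setU1r.
  move: cZ; rewrite inE cS /=; apply/negP; rewrite negbK.
  suff -> : o |: S :\ c = C by [].
  apply/eqP; rewrite eq_sym eqEcard; apply/andP; split.
    apply/subsetP=> y yC; have := subsetP sC _ yC; rewrite !inE.
    have neyc : y != c by apply: contraNneq cC' => <-.
    rewrite neyc; case/orP=> [/orP[->//|yZ]|->]; last by rewrite orbT.
    by move: yZ => /andP[->]; rewrite orbT.
  by rewrite cC cardsU1 (cardsD1 c S) cS !inE (negPf oS) andbF.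
have [[c cZ cO]|noc] : (exists2 c, c \in Z :\: O & M (c |: O :\ o)) \/
     (forall c, c \in Z :\: O -> ~~ M (c |: O :\ o)).
  case: (boolP [exists c in Z :\: O, M (c |: O :\ o)]) => [/exists_inP[c cZ cO]|].
    by left; exists c.
  by move=> /exists_inPn h; right.
  exists c; move: cZ; rewrite !inE => /andP[-> /andP[-> ->]].
  by rewrite cO.
exfalso.
have iOo : M (O :\ o) by apply: indepS iO; rewrite subsetDl.
have cOo : #|O| = (#|O :\ o|).+1 by rewrite (cardsD1 o O) oO.
have top Y : M Y -> Y \subset (O :\ o) :|: Z -> (#|Y| <= #|O :\ o|)%N.
  move=> iY sY; rewrite leqNgt; apply/negP=> ltY.
  have [c /setDP[cY cOo'] ic] := indep_aug iOo iY ltY.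
  have := subsetP sY _ cY; rewrite inE (negPf cOo') /= => cZ.
  have cneo : c != o by apply: contraNneq oS => <-; apply: (subsetP sZS).
  have cO : c \notin O by move: cOo'; rewrite !inE cneo.
  by move: (noc c); rewrite inE cO cZ ic => /(_ isT).
have iZ : M Z by apply: indepS iS.
have leZ : (#|Z| <= #|O :\ o|)%N by apply: top => //; exact: subsetUr.
have [Y [sZY sY iY cY]] := indep_extend iZ iOo leZ.
have ltY : (#|Y| < #|O|)%N by rewrite cY cOo.
have [x /setDP[xO xY] iYx] := indep_aug iY iO ltY.
have [xo|xno] := eqVneq x o.
  move/negP: dZ; apply; apply: indepS iYx; rewrite xo; exact: setUS.
have : (#|x |: Y| <= #|O :\ o|)%N.
  apply: top => //; apply/subsetP=> y; rewrite !inE => /orP[/eqP->|yY]; first by rewrite xno xO.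
  by have := subsetP sY _ yY; rewrite !inE orbC.
by rewrite cardsU1 xY cY ltnn.
Qed.

(** Takes the place of a perfect matching between [O :\: S] and [S :\: O]. An [o] that cannot be
    added is replaced by some [c] in [O] itself, so [c] leaves [S :\: O] and its loss is charged
    only once. *)
Lemma exchange_sum (R : realType) (q l : E -> R) S O : M S -> M O ->
  (forall c, 0 <= l c) ->
  (forall o, o \notin S -> M (o |: S) -> 0 <= q o) ->
  (forall o c, o \notin S -> c \in S -> M (o |: S :\ c) -> - l c <= q o) ->
  - (\sum_(c in S :\: O) l c) <= \sum_(o in O :\: S) q o.
Proof.
move=> iS + l0 hN hS; move: {2}(#|O :\: S|) (erefl #|O :\: S|) => d.
elim: d O => [|d IH] O cd iO.
  move/eqP: cd; rewrite cards_eq0 => /eqP ->; rewrite big_set0 oppr_le0.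
  exact: sumr_ge0.
have [o oOS] : exists o, o \in O :\: S by apply/set0Pn; rewrite -card_gt0 cd.
have /setDP[oO oS] := oOS.
rewrite (big_setD1 o oOS) /=.
case: (boolP (M (o |: S))) => [io|dS].
  have eO : O :\ o :\: S = O :\: S :\ o by apply/setP=> y; rewrite !inE; case: (y == o); case: (y \in S).
  have eS : S :\: (O :\ o) = S :\: O.
    apply/setP=> y; rewrite !inE; have [->|//] := eqVneq y o.
    by rewrite (negPf oS) !andbF.
  have cO : #|O :\ o :\: S| = d.
    by rewrite eO (card_setD1 oOS cd).
  have := IH _ cO (indepS (subsetDl _ _) iO).
  rewrite eO eS; have := hN o oS io; lra.
have [c [cSO ic icO]] := symmetric_exchange iS iO oO oS dS.
have /setDP[cS cO] := cSO.
have eO : (c |: O :\ o) :\: S = O :\: S :\ o.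
  apply/setP=> y; rewrite !inE; have [->|_] := eqVneq y c; first by rewrite cS /= andbF.
  by case: (y == o); case: (y \in S).
have eS : S :\: (c |: O :\ o) = S :\: O :\ c.
  apply/setP=> y; rewrite !inE; have [->//|_] := eqVneq y c.
  by have [->|//] := eqVneq y o; rewrite (negPf oS) !andbF.
have cOd : #|(c |: O :\ o) :\: S| = d.
  by rewrite eO (card_setD1 oOS cd).
have := IH _ cOd icO; rewrite eO eS (big_setD1 c cSO) /=.
have := hS o c oS cS ic; lra.
Qed.

End MatroidExchange.

Section Submodular.
Variables (R : realType) (E : finType) (f : {set E} -> R).
Hypotheses (f0 : nonnegative f) (fM : monotone f) (fS : submodular f).
Implicit Types (S O A B : {set E}).

Lemma submodular_marginal A B x : A \subset B -> x \notin B ->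
  f (x |: B) - f B <= f (x |: A) - f A.
Proof.
move=> sAB xB; have := fS (x |: A) B.
have -> : x |: A :|: B = x |: B by rewrite -setUA (setUidPr sAB).
have -> : (x |: A) :&: B = A.
  rewrite setIUl (setIidPl sAB); suff -> : [set x] :&: B = set0 by rewrite set0U.
  by apply/setP=> y; rewrite !inE; have [->|] := eqVneq y x; rewrite ?(negPf xB).
lra.
Qed.

Lemma sum_marginals S A : f (S :|: A) - f S <= \sum_(x in A :\: S) (f (x |: S) - f S).
Proof.
move: {2}(#|A :\: S|) (erefl #|A :\: S|) => d.
elim: d A => [|d IH] A cd.
  have := cards0_eq cd => e; rewrite e big_set0.
  suff -> : S :|: A = S by rewrite subrr.
  by apply/setUidPl; rewrite -setD_eq0 e.
have [x xAS] : exists x, x \in A :\: S by apply/set0Pn; rewrite -card_gt0 cd.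
have /setDP[xA xS] := xAS.
have eA : A :\ x :\: S = A :\: S :\ x by apply/setP=> y; rewrite !inE; case: (y == x); case: (y \in S).
rewrite (big_setD1 x xAS) /= -eA.
have cA : #|A :\ x :\: S| = d by rewrite eA (card_setD1 xAS cd).
have := IH _ cA.
have xn : x \notin S :|: A :\ x by rewrite !inE eqxx (negPf xS).
have := submodular_marginal (subsetUl S (A :\ x)) xn.
have -> : x |: (S :|: A :\ x) = S :|: A.
  by rewrite setUCA setD1K.
lra.
Qed.

(** By submodularity the loss of [c] from [S] is at most its marginal value over fewer items, and
    such marginals telescope. *)
Lemma sum_losses S : \sum_(c in S) (f S - f (S :\ c)) <= f S.
Proof.
have H A : A \subset S -> \sum_(c in A) (f S - f (S :\ c)) <= f A.
  move: {2}#|A| (erefl #|A|) => d; elim: d A => [|d IH] A cd sA.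
    by rewrite (cards0_eq cd) big_set0 f0.
  have [x xA] : exists x, x \in A by apply/set0Pn; rewrite -card_gt0 cd.
  rewrite (big_setD1 x xA) /=.
  have cA : #|A :\ x| = d by exact: card_setD1 xA cd.
  have := IH _ cA (subset_trans (subsetDl _ _) sA).
  have := submodular_marginal (setSD [set x] sA).
  move=> /(_ x); rewrite !inE eqxx => /(_ isT).
  rewrite !setD1K //; last exact: (subsetP sA).
  lra.
exact: H (subxx _).
Qed.

(* [v o] plays the role of the value of the best feasible swap of [o] into [S]. *)
Lemma swap_gains (M : matroid E) (v : E -> R) S O : M S -> M O ->
  (forall o, f S <= v o) ->
  (forall o, o \notin S -> M (o |: S) -> f (o |: S) <= v o) ->
  (forall o c, o \notin S -> c \in S -> M (o |: S :\ c) -> f (o |: S :\ c) <= v o) ->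
  f O - 2 * f S <= \sum_(o in O) (v o - f S).
Proof.
move=> iS iO v0 vN vS.
(* The factor 2 has two sources: the removed items may cost [f S] in total, and the marginals of [O]
   over [S] are only known to sum to [f O - f S]. *)
have hx := exchange_sum (q := fun o => v o - f (o |: S)) (l := fun c => f S - f (S :\ c)) iS iO.
have {}hx : - (\sum_(c in S :\: O) (f S - f (S :\ c))) <= \sum_(o in O :\: S) (v o - f (o |: S)).
  apply: hx => [c|o oS io|o c oS cS ic].
  - by rewrite subr_ge0 fM // subsetDl.
  - by rewrite subr_ge0 vN.
  - have := vS o c oS cS ic; have := submodular_marginal (subsetDl S [set c]) oS.
    by rewrite -/(S :\ c); lra.
have hs : \sum_(c in S :\: O) (f S - f (S :\ c)) <= f S.
  apply: le_trans (sum_losses S); rewrite [leRHS](big_setID O) /= lerDr.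
  by apply: sumr_ge0 => c _; rewrite subr_ge0 fM // subsetDl.
have hm := sum_marginals S O.
have hO : f O <= f (S :|: O) by rewrite fM // subsetUr.
have -> : \sum_(o in O) (v o - f S) = \sum_(o in O :&: S) (v o - f S) +
  (\sum_(o in O :\: S) (v o - f (o |: S)) + \sum_(o in O :\: S) (f (o |: S) - f S)).
  rewrite (big_setID S) /= -big_split /=; congr (_ + _); apply: eq_bigr => o _; ring.
have : 0 <= \sum_(o in O :&: S) (v o - f S) by apply: sumr_ge0 => o _; rewrite subr_ge0.
lra.
Qed.

End Submodular.

(** * Averages *)

Section Averages.
Variable R : realType.

Definition avg (T : finType) (F : T -> R) : R := #|T|%:R^-1 * \sum_x F x.

Lemma avg_le (T : finType) (F G : T -> R) : (forall x, F x <= G x) -> avg F <= avg G.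
Proof. by move=> FG; rewrite ler_wpM2l ?invr_ge0 ?ler0n // ler_sum. Qed.

Lemma eq_avg (T : finType) (F G : T -> R) : F =1 G -> avg F = avg G.
Proof. by move=> FG; rewrite /avg (eq_bigr G). Qed.

Lemma avg_ge0 (T : finType) (F : T -> R) : (forall x, 0 <= F x) -> 0 <= avg F.
Proof. by move=> F0; rewrite mulr_ge0 ?invr_ge0 ?ler0n // sumr_ge0. Qed.

Lemma avgD (T : finType) (F G : T -> R) : avg (fun x => F x + G x) = avg F + avg G.
Proof. by rewrite /avg big_split mulrDr. Qed.

Lemma avgZ (T : finType) c (F : T -> R) : avg (fun x => c * F x) = c * avg F.
Proof. by rewrite /avg -mulr_sumr mulrCA. Qed.

Lemma avgB (T : finType) (F G : T -> R) : avg (fun x => F x - G x) = avg F - avg G.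
Proof. by rewrite /avg sumrB mulrBr. Qed.

Lemma avg_const (T : finType) (c : R) : (0 < #|T|)%N -> avg (fun=> c : R) (T := T) = c.
Proof.
move=> T0; rewrite /avg sumr_const -[c *+ _]mulr_natl mulKf // pnatr_eq0; lia.
Qed.

Lemma avg_sum (T : finType) (I : Type) (r : seq I) (P : pred I) (F : I -> T -> R) :
  avg (fun x => \sum_(i <- r | P i) F i x) = \sum_(i <- r | P i) avg (F i).
Proof. by rewrite /avg exchange_big mulr_sumr. Qed.

Lemma avg_exchange (T V : finType) (F : T -> V -> R) :
  avg (fun x => avg (F x)) = avg (fun y => avg (F^~ y)).
Proof.
rewrite /avg -!mulr_sumr [in RHS]exchange_big /=; ring.
Qed.

Definition fupd (A B : finType) (phi : {ffun A -> B}) x j : {ffun A -> B} :=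
  [ffun y => if y == x then j else phi y].

Lemma avg_resample (A B : finType) x (G : {ffun A -> B} -> R) : (0 < #|B|)%N ->
  avg G = avg (fun phi => avg (fun j => G (fupd phi x j))).
Proof.
move=> B0; rewrite {2 3}/avg -mulr_sumr pair_bigA /=.
(* Exchanging the old and the new value at [x] is an involution on pairs, so the fresh value may be
   summed in place of [phi x]. *)
pose swap (p : {ffun A -> B} * B) := (fupd p.1 x p.2, p.1 x).
have swapK : involutive swap.
  move=> [phi j]; rewrite /swap /=; congr pair; last by rewrite ffunE eqxx.
  by apply/ffunP=> y; rewrite !ffunE; case: eqP => [->|].
rewrite (reindex_inj (inv_inj swapK)) /=.
have -> : \sum_(p : {ffun A -> B} * B) G (fupd (fupd p.1 x p.2) x (p.1 x)) =
          \sum_(p : {ffun A -> B} * B) G p.1.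
  apply: eq_bigr => p _; congr G.
  by apply/ffunP=> y; rewrite !ffunE; case: eqP => [->|].
rewrite -(pair_bigA _ (fun phi (_ : B) => G phi)) /=.
rewrite (eq_bigr (fun phi => #|B|%:R * G phi)); last first.
  by move=> phi _; rewrite big_const iter_addr_0 mulr_natl.
by rewrite -mulr_sumr mulKf // pnatr_eq0 -lt0n.
Qed.

(** The mean over [m] successive results of [Rand] with bound [e], nested in the order in which a
    filling loop draws them. *)
Fixpoint avgseq (e m : nat) (X : seq nat -> R) : R :=
  if m is m'.+1 then
    (e.+1)%:R^-1 * \sum_(j <- iota 0 e.+1) avgseq e m' (fun v => X (j :: v))
  else X [::].

Lemma avgseq_ffun (A : finType) (e : nat) (a : seq A) (X : seq nat -> R) : uniq a ->
  avgseq e (size a) X =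
  avg (fun phi : {ffun A -> 'I_e.+1} => X [seq val (phi x) | x <- a]).
Proof.
elim: a X => [|x a IH] X /=.
  by rewrite avg_const // card_ffun card_ord expn_gt0.
move=> /andP[xa ua]; rewrite (avg_resample x) ?card_ord //.
rewrite avg_exchange [in RHS]/avg card_ord; congr (_ * _).
rewrite -[_ :: iota 1 e]/(index_iota 0 e.+1) big_mkord; apply: eq_bigr => j _.
rewrite IH //; apply: eq_avg => phi; congr X; rewrite ffunE eqxx; congr cons.
apply/eq_in_map => y ya; rewrite ffunE; case: eqP => // yx.
by rewrite -yx ya in xa.
Qed.

Lemma avgseq_le e m (X Y : seq nat -> R) :
  (forall v, size v = m -> all (leq^~ e) v -> X v <= Y v) -> avgseq e m X <= avgseq e m Y.
Proof.
elim: m X Y => [|m IH] X Y XY; first exact: XY.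
rewrite [avgseq]lock /= -lock ler_wpM2l ?invr_ge0 ?ler0n //.
rewrite big_seq [leRHS]big_seq; apply: ler_sum => j; rewrite mem_iota add0n ltnS => /andP[_ je].
by apply: IH => v sv av; apply: XY => /=; rewrite ?sv // je.
Qed.

Lemma eq_avgseq e m (X Y : seq nat -> R) :
  (forall v, size v = m -> all (leq^~ e) v -> X v = Y v) -> avgseq e m X = avgseq e m Y.
Proof.
by move=> XY; apply/le_anti/andP; split; apply: avgseq_le => v sv av; rewrite XY.
Qed.

End Averages.

(** * Averages over uniformly random orders *)

Section PermutationAverages.
Variables (R : realType) (E : eqType).
Implicit Types (s u : seq E) (F G : seq E -> R).

Definition pavg u F : R := (size (permutations u))%:R^-1 * \sum_(s <- permutations u) F s.

Lemma size_permutations_gt0 u : (0 < size (permutations u))%N.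
Proof.
have : u \in permutations u by rewrite mem_permutations.
by case: (permutations u).
Qed.

Lemma pavg_le u F G : (forall s, perm_eq s u -> F s <= G s) -> pavg u F <= pavg u G.
Proof.
move=> FG; rewrite ler_wpM2l ?invr_ge0 ?ler0n //.
by rewrite big_seq [leRHS]big_seq; apply: ler_sum => s; rewrite mem_permutations; apply: FG.
Qed.

Lemma eq_pavg u F G : (forall s, perm_eq s u -> F s = G s) -> pavg u F = pavg u G.
Proof.
by move=> FG; apply/le_anti/andP; split; apply: pavg_le => s /FG ->.
Qed.

Lemma pavg_const u c : pavg u (fun=> c) = c.
Proof.
rewrite /pavg big_const_seq count_predT iter_addr_0 -[c *+ _]mulr_natl mulKf // pnatr_eq0.
by have := size_permutations_gt0 u; rewrite lt0n.
Qed.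

Lemma pavgZ u c F : pavg u (fun s => c * F s) = c * pavg u F.
Proof. by rewrite /pavg -mulr_sumr mulrCA. Qed.

Lemma pavgD u F G : pavg u (fun s => F s + G s) = pavg u F + pavg u G.
Proof. by rewrite /pavg big_split mulrDr. Qed.

Lemma pavg_avg (T : finType) u (F : seq E -> T -> R) :
  pavg u (fun s => avg (F s)) = avg (fun x => pavg u (F^~ x)).
Proof. rewrite /pavg /avg -!mulr_sumr exchange_big /=; ring. Qed.

Lemma pavg_avgseq e m u (F : seq E -> seq nat -> R) :
  pavg u (fun s => avgseq e m (F s)) = avgseq e m (fun v => pavg u (F^~ v)).
Proof.
elim: m F => [//|m IH] F; rewrite [avgseq]lock /= -lock pavgZ; congr (_ * _).
rewrite /pavg exchange_big mulr_sumr; apply: eq_bigr => j _.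
exact: (IH (fun s v => F s (j :: v))).
Qed.

Lemma permutations_rcons u : uniq u -> u != [::] ->
  perm_eq (permutations u) [seq rcons s x | x <- u, s <- permutations (rem x u)].
Proof.
move=> uu un; apply: uniq_perm; first exact: permutations_uniq.
  apply: allpairs_uniq_dep => // [x _|]; first exact: permutations_uniq.
  by move=> [x s] [x' s'] /= _ _ /rcons_inj[-> ->].
move=> s; rewrite mem_permutations; apply/idP/allpairsPdep => /=.
  case/lastP: s => [|s x] su; first by move: un; rewrite -size_eq0 -(perm_size su).
  have xu : x \in u by rewrite -(perm_mem su) mem_rcons mem_head.
  exists x, s; split=> //; rewrite mem_permutations.
  by rewrite -(perm_cons x) -(permPr (perm_to_rem xu)) -perm_rcons.
case=> x [s' [xu]]; rewrite mem_permutations => ps ->.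
by rewrite perm_rcons (permPr (perm_to_rem xu)) perm_cons.
Qed.

(** Conditioning on the last item drives every induction on random orders below. *)
Lemma pavg_rcons u F : uniq u -> u != [::] ->
  pavg u F = (size u)%:R^-1 * \sum_(x <- u) pavg (rem x u) (fun s => F (rcons s x)).
Proof.
move=> uu un; rewrite {1}/pavg (perm_big _ (permutations_rcons uu un)) /= big_allpairs_dep /=.
rewrite size_permutations // (_ : size u = (size u).-1.+1); last by case: (u) un.
rewrite factS natrM invfM -mulrA; congr (_ * _).
rewrite mulr_sumr [LHS]big_seq [RHS]big_seq; apply: eq_bigr => x xu.
by rewrite /pavg size_permutations ?rem_uniq // size_rem.
Qed.

(** The relative order of some of the items is itself uniform; this isolates a single window. *)
Lemma pavg_filter (P : pred E) u F : uniq u ->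
  pavg u (fun s => F (filter P s)) = pavg (filter P u) F.
Proof.
move: {2}(size u) (erefl (size u)) => m; elim: m u F => [|m IH] u F.
  by move=> /size0nil -> _ /=; apply: eq_pavg => s /perm_nilP ->.
move=> su uu; have un : u != [::] by case: (u) su.
rewrite pavg_rcons //.
have -> : \sum_(x <- u) pavg (rem x u) (fun s => F (filter P (rcons s x))) =
   \sum_(x <- u) (if P x then pavg (rem x (filter P u)) (fun s => F (rcons s x))
                  else pavg (filter P u) F).
  rewrite big_seq [RHS]big_seq; apply: eq_bigr => x xu.
  have sr : size (rem x u) = m by rewrite size_rem // su.
  have ur : uniq (rem x u) by exact: rem_uniq.
  have fr : filter P (rem x u) = rem x (filter P u).
    rewrite !rem_filter ?filter_uniq // -!filter_predI.
    by apply: eq_filter => y /=; rewrite andbC.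
  case: ifP => Px.
    rewrite -fr -(IH _ (fun s => F (rcons s x))) //; apply: eq_pavg => s _.
    by rewrite filter_rcons Px.
  have fu : filter P u = filter P (rem x u).
    rewrite fr rem_id // mem_filter Px //.
  rewrite fu -IH //; apply: eq_pavg => s _.
  by rewrite filter_rcons Px.
rewrite big_if /= big_const_seq iter_addr_0.
have [f0|fn0] := eqVneq (filter P u) [::].
  have cP : count P u = 0%N by rewrite -size_filter f0.
  rewrite -big_filter f0 big_nil add0r (_ : count _ u = size u).
    by rewrite -[pavg _ _ *+ _]mulr_natl mulKf // su pnatr_eq0.
  by have := count_predC P u; rewrite cP.
have fsz : (size (filter P u))%:R != 0 :> R by rewrite pnatr_eq0 size_eq0.
have -> : \sum_(x <- u | P x) pavg (rem x (filter P u)) (fun s => F (rcons s x)) =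
   (size (filter P u))%:R * pavg (filter P u) F.
  by rewrite -big_filter (pavg_rcons _ (filter_uniq _ uu) fn0) mulVKf.
rewrite -[pavg _ _ *+ _]mulr_natl -mulrDl -natrD size_filter.
by rewrite (count_predC P u) mulKf // su pnatr_eq0.
Qed.

(** Reading the positions in a fixed order is injective on the finite set of arrival orders, hence
    permutes it. *)
Lemma pavg_rearrange x0 u (p : seq nat) F : uniq u -> perm_eq p (iota 0 (size u)) ->
  pavg u F = pavg u (fun s => F [seq nth x0 s i | i <- p]).
Proof.
move=> uu pp; rewrite /pavg; congr (_ * _).
pose h s := [seq nth x0 s i | i <- p].
rewrite -(big_map h predT F); apply: perm_big; rewrite perm_sym.
have hperm s : perm_eq s u -> perm_eq (h s) u.
  move=> su; have ssu := perm_size su; apply: perm_trans su; rewrite /h -[X in perm_eq _ X](mkseq_nth x0).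
  by apply: perm_map; rewrite ssu.
have hinj : {in permutations u &, injective h}.
  move=> s t; rewrite !mem_permutations => su tu /eq_in_map hst.
  apply: (@eq_from_nth _ x0); first by rewrite (perm_size su) (perm_size tu).
  by move=> i si; apply: hst; rewrite (perm_mem pp) mem_iota -(perm_size su).
have uh : uniq (map h (permutations u)) by rewrite map_inj_in_uniq ?permutations_uniq.
apply: uniq_perm => //; first exact: permutations_uniq.
have sub : {subset map h (permutations u) <= permutations u}.
  by move=> t /mapP[s]; rewrite !mem_permutations => /hperm ? ->.
by have [] := uniq_min_size uh sub; rewrite ?size_map.
Qed.

End PermutationAverages.

(** * Best offers *)

Section Lexicographic.
Variable R : realType.
Implicit Types p q : R * nat.

(** Value first, then key, spelled with the comparisons and connectives of [bexp] so that the test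
    in [compare] evaluates to it. *)
Definition lexle p q := (p.1 <= q.1) && ~~ ((q.1 <= p.1) && (q.2 < p.2)%N).

Lemma lexle_refl p : lexle p p.
Proof. by rewrite /lexle lexx ltnn. Qed.

Lemma lexle_trans q p r : lexle p q -> lexle q r -> lexle p r.
Proof.
rewrite /lexle !negb_and -!ltNge -!leqNgt => /andP[pq pq2] /andP[qr qr2].
rewrite (le_trans pq qr) /=; case/orP: pq2 => [h|pq2]; first by rewrite (lt_le_trans h qr).
case/orP: qr2 => [h|qr2]; first by rewrite (le_lt_trans pq h).
by rewrite (leq_trans pq2 qr2) orbT.
Qed.

Lemma lexle_total p q : lexle p q || lexle q p.
Proof.
rewrite /lexle !negb_and -!ltNge -!leqNgt.
by case: (ltgtP p.1 q.1) => //= _; exact: leq_total.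
Qed.

Lemma lexle_anti p q : lexle p q -> lexle q p -> p = q.
Proof.
case: p q => [a b] [c d]; rewrite /lexle !negb_and -!ltNge -!leqNgt /=.
by case: (ltgtP a c) => //= -> h1 h2; congr pair; lia.
Qed.

Lemma lexleNW p q : ~~ lexle p q -> lexle q p.
Proof. by have := lexle_total p q => /orP[->|->]. Qed.

End Lexicographic.

Section FirstMaximum.
Variables (R : realType) (T : eqType) (k : T -> R * nat).
Implicit Types (b x : T) (xs : seq T).

Definition challenge b x := if lexle (k x) (k b) then b else x.
Definition fmax := foldl challenge.

Lemma fmax_rcons b xs x : fmax b (rcons xs x) = challenge (fmax b xs) x.
Proof. by rewrite /fmax foldl_rcons. Qed.

Lemma fmax_ge b xs x : x \in b :: xs -> lexle (k x) (k (fmax b xs)).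
Proof.
elim/last_ind: xs => [|xs y IH]; first by rewrite inE => /eqP->; exact: lexle_refl.
rewrite fmax_rcons /challenge inE mem_rcons inE orbCA => /orP[/eqP->|xin].
  by case: ifP => // _; exact: lexle_refl.
have {}IH : lexle (k x) (k (fmax b xs)) by apply: IH; rewrite inE.
by case: ifPn => // /lexleNW; exact: lexle_trans.
Qed.

Lemma fmax_mem b xs : fmax b xs \in b :: xs.
Proof.
elim/last_ind: xs => [|xs y]; first by rewrite mem_head.
rewrite fmax_rcons /challenge !inE mem_rcons inE.
by case: ifP => _; [case/orP=> ->; rewrite ?orbT | rewrite eqxx orbT].
Qed.

Lemma fmax_strict b xs : fmax b xs = b \/ ~~ lexle (k (fmax b xs)) (k b).
Proof.
elim/last_ind: xs => [|xs y IH]; first by left.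
rewrite fmax_rcons /challenge; case: ifPn => // ny.
case: IH => [e|h]; right; first by rewrite e in ny.
by apply: contra h; apply: lexle_trans; exact: lexleNW.
Qed.

Lemma fmax_filter (a : pred T) b xs : a (fmax b xs) ->
  fmax b (filter a xs) = fmax b xs.
Proof.
(* The induction also follows the case in which the current winner is filtered out: the filtered
   maximum then stays behind the true one until an item satisfying [a] takes the lead in both. *)
suff [->//|[/negPf-> //]] : fmax b (filter a xs) = fmax b xs \/
    ~~ a (fmax b xs) /\ lexle (k (fmax b (filter a xs))) (k (fmax b xs)).
elim/last_ind: xs => [|xs x]; first by left.
rewrite filter_rcons fmax_rcons => IH.
case: IH => [e|[na le]].
  case: (boolP (a x)) => ax; first by left; rewrite fmax_rcons e.
  rewrite e /challenge; case: ifPn => ny; first by left.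
  by right; split=> //; exact: lexleNW.
case: (boolP (a x)) => ax; rewrite ?fmax_rcons /challenge; last first.
  right; case: ifPn => ny //; split=> //.
  exact: lexle_trans le (lexleNW ny).
case: (boolP (lexle (k x) (k (fmax b xs)))) => ny.
  by right; split=> //; case: ifP.
left; case: ifPn => // nx; case/negP: ny; exact: lexle_trans nx le.
Qed.

(** Injective keys exclude ties among the candidates, so their order does not matter. A tie with [b]
    is always won by [b], whence the case distinction. *)
Lemma eq_mem_fmax b xs ys : xs =i ys -> {in xs &, injective k} ->
  fmax b xs = fmax b ys.
Proof.
move=> xy inj.
have mono us vs : us =i vs -> fmax b us = b -> fmax b vs = b.
  move=> uv eb; have := fmax_mem b vs; rewrite inE => /orP[/eqP//|].
  rewrite -uv => vin; case: (fmax_strict b vs) => // /negP[]; rewrite -{2}eb.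
  by apply: fmax_ge; rewrite inE vin orbT.
case: (eqVneq (fmax b xs) b) => [e|nx]; first by rewrite e (mono xs ys).
case: (eqVneq (fmax b ys) b) => [e|ny].
  by rewrite (mono ys xs) // in nx; rewrite ?eqxx // in nx => ?; rewrite xy.
have xin : fmax b xs \in xs by have := fmax_mem b xs; rewrite inE (negPf nx).
have yin : fmax b ys \in xs by have := fmax_mem b ys; rewrite inE (negPf ny) xy.
apply: inj => //; apply: lexle_anti; apply: fmax_ge; rewrite inE ?yin ?orbT //.
by rewrite -xy xin orbT.
Qed.

End FirstMaximum.

(** * The selected set stored in cells *)

Section Cells.
Variable E : finType.
Implicit Types S : seq (option E).

Definition items S : {set E} := [set x in pmap id S].
Definition put S c e : seq (option E) := set_nth None S c e.

Lemma in_items S x : (x \in items S) = (Some x \in S).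
Proof. by rewrite inE mem_pmap map_id. Qed.

Lemma put_cat S c : (c < size S)%N -> exists A B,
  S = A ++ nth None S c :: B /\ forall e, put S c e = A ++ e :: B.
Proof.
move=> cS; exists (take c S), (drop c.+1 S); split; first by rewrite -drop_nth // cat_take_drop.
by move=> e; rewrite /put set_nthE cS.
Qed.

Lemma size_put S c e : (c < size S)%N -> size (put S c e) = size S.
Proof. by move=> cS; rewrite /put size_set_nth; apply/maxn_idPr. Qed.

Lemma put_nth S c : (c < size S)%N -> put S c (nth None S c) = S.
Proof. by case/put_cat => A [B [e h]]; rewrite h -e. Qed.

Lemma in_put S c e x : (c < size S)%N -> Some x \in put S c e -> Some x = e \/ Some x \in S.
Proof.
case/put_cat => A [B [e' h]]; rewrite h [in X in _ \/ X]e' !mem_cat !inE.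
case/or3P=> [->|/eqP->|->]; rewrite ?orbT; by [right | left].
Qed.

Lemma items_put_mem S c e : (c < size S)%N ->
  (if e is Some x then x \in items S else true) -> items (put S c e) \subset items S.
Proof.
move=> cS he; apply/subsetP => x; rewrite !in_items => /(in_put cS)[] // ex.
by move: he; rewrite -ex in_items.
Qed.

Lemma uniq_put S c x : (c < size S)%N -> uniq (pmap id S) -> Some x \notin S ->
  uniq (pmap id (put S c (Some x))).
Proof.
case/put_cat => A [B [e' ->]]; rewrite [in X in X -> _]e' [in X in _ -> X -> _]e' !pmap_cat /= !cat_uniq /= mem_cat !inE => hu.
rewrite negb_or => /andP[xA]; rewrite negb_or => /andP[_ xB].
rewrite !mem_pmap !map_id xB negb_or xA /=.
have sub : {subset pmap id B <= pmap id (nth None S c :: B)}.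
  by move=> y; rewrite !mem_pmap !map_id inE => ->; rewrite orbT.
case/and3P: hu => -> h1 h2 /=; apply/andP; split.
  by apply: contra h1; case/hasP=> y /sub yB yA; apply/hasP; exists y.
by move: h2 => /=; case: (nth None S c) => //= ? /andP[].
Qed.

Lemma items_put_none S c x : (c < size S)%N -> nth None S c = None ->
  items (put S c (Some x)) = x |: items S.
Proof.
move=> cS cN; apply/setP => y; rewrite !inE !mem_pmap !map_id.
have [A [B [-> ->]]] := put_cat cS; rewrite cN !mem_cat !inE /=.
by case: (Some y \in A); rewrite ?orbT //= orbF.
Qed.

Lemma items_put_some S c x y : (c < size S)%N -> nth None S c = Some y ->
  uniq (pmap id S) -> items (put S c (Some x)) = x |: items S :\ y.
Proof.
move=> cS cy; have [A [B [h ->]]] := put_cat cS; rewrite h cy pmap_cat cat_uniq /=.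
rewrite negb_or -!andbA => /and5P[_ yA _ yB _].
apply/setP => z; rewrite !inE !mem_pmap !map_id !mem_cat !inE.
have [->|zy] := eqVneq z y.
  move: yA yB; rewrite !mem_pmap !map_id => /negPf-> /negPf->.
  by rewrite orbF.
by rewrite (_ : (Some z == Some y) = (z == y)) // (negPf zy) /= orbCA.
Qed.

Lemma card_items S : uniq (pmap id S) -> None \notin S -> #|items S| = size S.
Proof.
move=> uS nS; rewrite cardsE (card_uniqP uS) size_pmap; apply/eqP; rewrite -all_count.
by apply/allP=> -[//|hN]; rewrite hN in nS.
Qed.

End Cells.

(** * The state of the algorithm *)

Section Model.
Variables (R : realType) (E : finType) (M : matroid E) (f : {set E} -> R).
Variables (kk K : nat).
Implicit Types (S sel : seq (option E)) (e : option E) (lam : E -> nat) (zs : nat -> seq E).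

Definition swap_step S e (p : R * nat) c : R * nat :=
  let A := items (put S c e) in if M A && (p.1 < f A) then (f A, c) else p.

(** Writing into an empty cell is an addition, so one scan covers additions and exchanges. Only
    strict improvements count: under a monotone [f], an item already present, or [None], leaves the
    initial pair. *)
Definition swap_value S e : R * nat := foldl (swap_step S e) (f (items S), 0%N) (iota 0 kk).

Definition offer S e (key : nat) : (R * nat) * (option E * nat) :=
  let p := swap_value S e in ((p.1, key), (e, p.2)).

(* The key [K] exceeds every tie-breaking key, so that only strict improvements
   of the current value are selected. *)
Definition idle S : (R * nat) * (option E * nat) := ((f (items S), K), (nth None S 0, 0%N)).

Definition offers S lam (z : seq E) := [seq offer S (Some x) (lam x) | x <- z].

(** With key 0 the rechecked item loses every tie in value. *)
Definition window_best S sel lam z (r : nat) :=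
  fmax fst (idle S) (rcons (offers S lam z) (offer S (nth None sel r) 0)).

(** The second component records what each window wrote, repetitions and [None] included, so that a
    recheck index is simply the index of a window. *)
Fixpoint state lam (rho : nat -> nat) zs w : seq (option E) * seq (option E) :=
  if w is w'.+1 then
    let st := state lam rho zs w' in
    let b := window_best st.1 st.2 lam (zs w') (rho w') in
    (put st.1 b.2.2 b.2.1, rcons st.2 b.2.1)
  else (nseq kk None, [::]).

Lemma swap_value_spec S e : let p := swap_value S e in
  [/\ f (items S) <= p.1,
      p = (f (items S), 0%N) \/ [/\ (p.2 < kk)%N, M (items (put S p.2 e)),
        f (items (put S p.2 e)) = p.1 & f (items S) < p.1] &
      forall c, (c < kk)%N -> M (items (put S c e)) -> f (items (put S c e)) <= p.1].
Proof.
rewrite /swap_value; elim: kk => [|k]; first by split=> //; left.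
rewrite -[k.+1]addn1 iotaD foldl_cat add0n /=; move: (foldl _ _ (iota 0 k)) => p [h1 h2 h3].
rewrite /swap_step; case: ifP => [/andP[iA ltA]|hA] /=; split.
- exact: ltW (le_lt_trans h1 ltA).
- right; split=> //; first by rewrite addn1.
  exact: le_lt_trans h1 ltA.
- move=> c; rewrite addn1 ltnS leq_eqVlt => /orP[/eqP-> //|ck ic].
  exact: le_trans (h3 c ck ic) (ltW ltA).
- by [].
- case: h2 => [->|[? ? ? ?]]; [by left|right; split=> //; lia].
- move=> c; rewrite addn1 ltnS leq_eqVlt => /orP[/eqP-> iA|ck ic]; last exact: h3.
  by move: hA; rewrite iA /= => /negbT; rewrite -leNgt.
Qed.

Hypotheses (f0 : nonnegative f) (fM : monotone f) (fS : submodular f).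
Hypothesis kk0 : (0 < kk)%N.

(** Making no swap is encoded as rewriting cell 0 with its own content, so that every window ends
    with one write. *)
Lemma put_idle S : size S = kk -> put S (idle S).2.2 (idle S).2.1 = S.
Proof. by move=> sS; apply: put_nth; rewrite sS. Qed.

Lemma window_best_spec S sel lam z r : size S = kk -> (forall x, (lam x < K)%N) ->
  M (items S) -> let b := window_best S sel lam z r in
  [/\ (b.2.2 < kk)%N, M (items (put S b.2.2 b.2.1)), f (items (put S b.2.2 b.2.1)) = b.1.1 &
      b = idle S \/ exists x, [/\ b.2.1 = Some x, Some x \notin S &
        (b = offer S (Some x) (lam x) /\ x \in z) \/ Some x = nth None sel r]].
Proof.
move=> sS lok iS b.
have [e|h] := fmax_strict fst (idle S) (rcons (offers S lam z) (offer S (nth None sel r) 0)).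
  by rewrite /b /window_best e put_idle //; split=> //; left.
have : b \in rcons (offers S lam z) (offer S (nth None sel r) 0).
  have := fmax_mem fst (idle S) (rcons (offers S lam z) (offer S (nth None sel r) 0)).
  by rewrite inE => /orP[/eqP e|//]; move: h; rewrite e lexle_refl.
rewrite -/(window_best S sel lam z r) -/b in h *.
rewrite mem_rcons inE => bin.
have [e [key [be keyK he]]] : exists e key, [/\ b = offer S e key, (key <= K)%N &
    e = nth None sel r \/ exists x, [/\ e = Some x, b = offer S (Some x) (lam x) & x \in z]].
  case/orP: bin => [/eqP->|/mapP[x xz ->]].
    by exists (nth None sel r), 0%N; split=> //; left.
  exists (Some x), (lam x); split=> //; first by apply: ltnW; exact: lok.
  by right; exists x.
have lt : f (items S) < b.1.1.
  move: h; rewrite be /offer /lexle /= negb_and negbK -ltNge => /orP[//|/andP[_]].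
  by rewrite ltnNge keyK.
have [_ hp _] := swap_value_spec S e.
case: hp => [ep|[h1 h2 h3 _]].
  by move: lt; rewrite be /offer ep /= ltxx.
(* Writing [None] or an item already present cannot enlarge the set, so monotonicity excludes the
   strict improvement. *)
have nmem : ~~ (if e is Some x then x \in items S else true).
  apply/negP => /(items_put_mem (c := (swap_value S e).2)); rewrite sS => /(_ h1) /fM.
  by rewrite h3 leNgt; move: lt; rewrite be => ->.
rewrite {1 2 3 4 5 6}be /=; split=> //; right.
case: e he be nmem {h1 h2 h3 } => [x|//] he be; rewrite in_items => nmem.
exists x; rewrite be /=; split=> //.
case: he => [he|[y [[exy] e2 yz]]]; first by right.
by left; rewrite exy yz -e2 be exy.
Qed.

Definition ok (U : {set E}) (st : seq (option E) * seq (option E)) :=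
  [/\ size st.1 = kk, M (items st.1), uniq (pmap id st.1),
      (forall x, Some x \in st.1 -> Some x \in st.2) &
      (forall x, Some x \in st.2 -> x \in U)].

Section Run.
Variables (U : {set E}) (lam : E -> nat) (rho : nat -> nat).
Hypothesis lok : forall x, (lam x < K)%N.

Lemma size_sel zs w : size (state lam rho zs w).2 = w.
Proof. by elim: w => //= w IH; rewrite size_rcons IH. Qed.

Lemma state_ok zs w : (forall u, {subset zs u <= U}) -> ok U (state lam rho zs w).
Proof.
move=> sub; elim: w => [|w] /=.
  split=> //=; first by rewrite size_nseq.
  - by rewrite (_ : items _ = set0) ?indep0 //; apply/setP=> x; rewrite in_items !inE mem_nseq andbF.
  - by elim: (kk) => //=.
  - by move=> x; rewrite mem_nseq andbF.
move: (state lam rho zs w) => [S sel] [/= sS iS uS hS hsel].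
have [bk bM _ hb] := window_best_spec sel (zs w) (rho w) sS lok iS.
have bS : ((window_best S sel lam (zs w) (rho w)).2.2 < size S)%N by rewrite sS.
split=> //=.
- by rewrite size_put.
- case: hb => [->|[x [-> xS _]]]; first by rewrite put_idle.
  exact: uniq_put.
- move=> x /(in_put bS); rewrite mem_rcons inE => -[->|/hS ->]; rewrite ?eqxx ?orbT //.
- move=> x; rewrite mem_rcons inE => /orP[/eqP ex|/hsel //].
  case: hb => [e|[y [ey yS hy]]].
    by apply/hsel/hS; rewrite ex e /= mem_nth // sS.
  move: ex; rewrite ey => -[->]; case: hy => [[_ /sub //]|hy].
  apply: hsel; rewrite hy mem_nth // ltnNge; apply/negP => hr.
  by move: hy; rewrite nth_default.
Qed.

Lemma state_gain zs w : (forall u, {subset zs u <= U}) ->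
  let st := state lam rho zs w in let S' := (state lam rho zs w.+1).1 in
  [/\ f (items st.1) <= f (items S'),
      (forall x, x \in zs w -> (swap_value st.1 (Some x)).1 <= f (items S')) &
      (swap_value st.1 (nth None st.2 (rho w))).1 <= f (items S')].
Proof.
move=> sub /=; have [] := state_ok w sub; move: (state lam rho zs w) => [S sel] /= sS iS uS hS hsel.
have [_ _ -> _] := window_best_spec sel (zs w) (rho w) sS lok iS.
have ge e key : offer S e key \in idle S :: rcons (offers S lam (zs w)) (offer S (nth None sel (rho w)) 0) ->
    (swap_value S e).1 <= (window_best S sel lam (zs w) (rho w)).1.1.
  by move/(fmax_ge fst) => /andP[].
split.
- have : idle S \in idle S :: rcons (offers S lam (zs w)) (offer S (nth None sel (rho w)) 0) by rewrite mem_head.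
  by move/(fmax_ge fst) => /andP[].
- move=> x xz; apply: (ge _ (lam x)).
  rewrite inE mem_rcons inE; apply/orP; right; apply/orP; right.
  by apply/mapP; exists x.
- by apply: (ge _ 0%N); rewrite inE mem_rcons mem_head orbT.
Qed.

Lemma state_swap_gains zs w (O : {set E}) : (forall u, {subset zs u <= U}) ->
  (forall A : {set E}, A \subset U -> M A -> (#|A| <= kk)%N) -> O \subset U -> M O ->
  let S := (state lam rho zs w).1 in
  f O - 2 * f (items S) <= \sum_(o in O) ((swap_value S (Some o)).1 - f (items S)).
Proof.
move=> sub hk sO iO /=; have [] := state_ok w sub.
move: (state lam rho zs w) => [S sel] /= sS iS uS hS hsel.
(* [swap_gains] asks for bounds at every item. Outside [U], where the cardinality bound says
   nothing, a value that is large enough is supplied. *)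
pose v o := if o \in U then (swap_value S (Some o)).1 else f U + f (o |: items S).
rewrite (eq_bigr (fun o => v o - f (items S))) => [|o /(subsetP sO) oU]; last by rewrite /v oU.
have sSU : items S \subset U by apply/subsetP=> x; rewrite in_items => /hS/hsel.
apply: (swap_gains f0 fM fS iS iO).
- move=> o; rewrite /v; case: ifP => _; first by have [] := swap_value_spec S (Some o).
  by have := fM sSU; have := f0 (o |: items S); lra.
- move=> o oS io; rewrite /v; case: ifP => oU; last by rewrite lerDr f0.
  have [_ _ h] := swap_value_spec S (Some o).
  (* If [o] can be added, some cell is empty: otherwise [U] would contain more than [kk] independent
     items. *)
  have nS : None \in S.
    apply/negPn/negP => nN; have := card_items uS nN; rewrite sS => cS.
    have : (#|o |: items S| <= kk)%N by apply: hk => //; rewrite subUset sub1set oU.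
    by rewrite cardsU1 oS cS ltnn.
  have iN : (index None S < size S)%N by rewrite index_mem.
  have := h (index None S); rewrite -{1}sS items_put_none ?nth_index //.
  by apply.
- move=> o c oS; rewrite in_items => cS ic; rewrite /v; case: ifP => oU; last first.
    by have := f0 U; have := @fM (o |: items S :\ c) (o |: items S) (setUS _ (subsetDl _ _)); lra.
  have [_ _ h] := swap_value_spec S (Some o).
  have iN : (index (Some c) S < size S)%N by rewrite index_mem.
  have := h (index (Some c) S); rewrite -{1}sS (items_put_some _ iN (nth_index None cS) uS).
  by apply.
Qed.

Lemma eq_state zs zs' rho' w : (forall u, (u < w)%N -> zs u = zs' u /\ rho u = rho' u) ->
  state lam rho zs w = state lam rho' zs' w.
Proof.
elim: w => //= w IH h; rewrite -IH => [|u uw]; last by apply: h; rewrite ltnS ltnW.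
by have [-> ->] := h w (ltnSn w).
Qed.

(** The winner of each window is not [i], and a maximum survives the removal of another candidate.
    This is the independence behind the probability [1 / W]. *)
Lemma state_remove i zs zs' w :
  (forall u, (u < w)%N -> zs' u = [seq x <- zs u | x != i]) ->
  Some i \notin (state lam rho zs w).2 ->
  state lam rho zs' w = state lam rho zs w.
Proof.
elim: w => //= w IH h; rewrite mem_rcons inE negb_or => /andP[nb nsel].
rewrite IH // => [|u uw]; last by apply: h; rewrite ltnS ltnW.
suff -> : forall S sel, Some i \notin sel -> Some i != (window_best S sel lam (zs w) (rho w)).2.1 ->
  window_best S sel lam (zs' w) (rho w) = window_best S sel lam (zs w) (rho w) by [].
move=> {nb nsel IH} S sel nsel; rewrite h // eq_sym => nb.
rewrite /window_best -[RHS](@fmax_filter _ _ fst (fun b => b.2.1 != Some i)) //.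
rewrite filter_rcons /= (_ : nth None sel (rho w) != Some i); last first.
  have [lt|ge] := ltnP (rho w) (size sel); last by rewrite nth_default.
  by apply: contraNneq nsel => <-; exact: mem_nth.
by rewrite /offers filter_map.
Qed.

(* Items enter [sel] only through their own window: the rechecked items and the
   ones already in a cell are in [sel] already. *)
Lemma sel_first zs w x : (forall u, {subset zs u <= U}) ->
  Some x \in (state lam rho zs w).2 -> exists2 u, (u < w)%N /\ x \in zs u &
    let st := state lam rho zs u in
    fmax fst (idle st.1) (offers st.1 lam (zs u)) = offer st.1 (Some x) (lam x) /\
    ~~ lexle (offer st.1 (Some x) (lam x)).1 (idle st.1).1.
Proof.
move=> sub; elim: w => //= w IH.
rewrite mem_rcons inE => /orP[/eqP ex|/IH[u [uw xu] h]]; last by exists u => //; split=> //; exact: ltnW.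
have [] := state_ok w sub; move: IH ex; case est : (state lam rho zs w) => [S sel] /= IH ex sS iS uS hS hsel.
suff : Some x \in sel \/ [/\ x \in zs w,
    fmax fst (idle S) (offers S lam (zs w)) = offer S (Some x) (lam x) &
    ~~ lexle (offer S (Some x) (lam x)).1 (idle S).1].
  case=> [/IH[u [uw xu] h]|[xw h1 h2]]; first by exists u => //; split=> //; exact: ltnW.
  by exists w => //; rewrite est.
have [_ _ _ [e|[y [ey yS hy]]]] := window_best_spec sel (zs w) (rho w) sS lok iS.
  by left; apply: hS; rewrite ex e /= mem_nth // sS.
move: ex; rewrite ey => -[exy]; case: hy => [[eb yz]|hy]; last first.
  left; rewrite exy hy mem_nth // ltnNge; apply/negP => hr.
  by move: hy; rewrite nth_default.
move: (eb); rewrite /window_best fmax_rcons /challenge.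
case: ifP => _ e.
  right; rewrite exy; split=> //.
  have [eb'|] := fmax_strict fst (idle S) (offers S lam (zs w)); last by rewrite e.
  by case/negP: yS; move: e; rewrite eb' => -[_ _ <- _]; rewrite mem_nth // sS.
left; case: (e) => _ _ en _; rewrite exy -en mem_nth // ltnNge; apply/negP => hr.
by move: en; rewrite nth_default.
Qed.

End Run.
End Model.

(** * Expected gain of a window *)

Section Drift.
Variables (R : realType) (E : finType) (M : matroid E) (f : {set E} -> R).
Hypotheses (f0 : nonnegative f) (fM : monotone f) (fS : submodular f).
Variables (kk K Wm : nat).
Hypothesis kk0 : (0 < kk)%N.
Local Notation W := Wm.+1.
Hypothesis kkW : (kk <= W)%N.
Variables (U O : {set E}) (s : seq E) (lam : E -> nat).
Hypothesis sU : s =i U.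
Hypothesis lok : forall x, (lam x < K)%N.
Hypothesis Ukk : forall A : {set E}, A \subset U -> M A -> (#|A| <= kk)%N.
Hypotheses (OU : O \subset U) (iO : M O).
Implicit Types (phi : {ffun E -> 'I_W}) (rho : {ffun 'I_W -> 'I_W}).

Definition windows phi u : seq E := [seq x <- s | val (phi x) == u].
Definition recheck rho u : nat := val (rho (inord u)).
Local Notation st phi rho w := (state M f kk K lam (recheck rho) (windows phi) w).
Local Notation fval phi rho w := (f (items (st phi rho w).1)).

Lemma windows_sub phi u : {subset windows phi u <= U}.
Proof. by move=> x; rewrite mem_filter sU => /andP[]. Qed.

Lemma state_move phi rho (w : 'I_W) i : Some i \notin (st phi rho w).2 ->
  st (fupd phi i w) rho w = st phi rho w.
Proof.
move=> ni; apply: (@state_remove _ _ _ _ _ _ _ _ i) => // u uw.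
rewrite /windows -filter_predI; apply: eq_filter => x /=; rewrite ffunE.
by have [->|//] := eqVneq x i; rewrite gtn_eqF.
Qed.

Definition gain phi rho w o : R := (swap_value M f kk (st phi rho w).1 (Some o)).1 - fval phi rho w.
Definition fresh phi rho w o : R := (Some o \notin (st phi rho w).2)%:R * gain phi rho w o.

Lemma gain_ge0 phi rho w o : 0 <= gain phi rho w o.
Proof. by rewrite subr_ge0; have [] := swap_value_spec M f kk (st phi rho w).1 (Some o). Qed.

Lemma fresh_ge0 phi rho w o : 0 <= fresh phi rho w o.
Proof. by rewrite mulr_ge0 ?ler0n ?gain_ge0. Qed.

(** A maximum and not a sum, because a window makes only one swap. *)
Fixpoint best_fresh (B : seq E) phi rho (w : 'I_W) : R :=
  if B is o :: B' then
    Num.max (best_fresh B' phi rho w) ((phi o == w)%:R * fresh phi rho w o)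
  else 0.

Lemma best_fresh_ge0 B phi rho w : 0 <= best_fresh B phi rho w.
Proof. by case: B => //= o B; rewrite le_max [X in _ || X]mulr_ge0 ?ler0n ?fresh_ge0 ?orbT. Qed.

Lemma best_fresh_move (B : seq E) phi rho (w : 'I_W) i : i \notin B -> Some i \notin (st phi rho w).2 ->
  best_fresh B (fupd phi i w) rho w = best_fresh B phi rho w.
Proof.
elim: B => //= o B IH; rewrite inE negb_or => /andP[io iB] ni; rewrite IH //.
by rewrite /fresh /gain state_move // ffunE [o == i]eq_sym (negPf io).
Qed.

Local Notation iW := (W%:R^-1 : R).

Lemma iW_gt0 : 0 < iW. Proof. by rewrite invr_gt0 ltr0n. Qed.
Lemma iW_le1 : iW <= 1. Proof. by rewrite invf_le1 ?ltr0n // ler1n. Qed.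

(** Resample [phi i]: the value [w] has probability [1 / W], and there [Y] is at least what it was
    before. This bounds a conditional probability without any conditioning. *)
Lemma avg_move (w : 'I_W) i (Y : {ffun E -> 'I_W} -> R) :
  (forall phi, Y phi <= Y (fupd phi i w)) ->
  iW * avg Y <= avg (fun phi => (phi i == w)%:R * Y phi).
Proof.
move=> hY; rewrite (avg_resample i (fun phi => (phi i == w)%:R * Y phi)) ?card_ord //.
rewrite -avgZ; apply: avg_le => phi.
rewrite /avg card_ord ler_wpM2l ?(ltW iW_gt0) // (bigD1 w) //= ffunE eqxx eqxx mul1r big1 ?addr0 //.
by move=> j jw; rewrite ffunE eqxx (negPf jw) mul0r.
Qed.

Lemma avg_best_fresh_cons rho (w : 'I_W) o (B : seq E) : o \notin B ->
  (1 - iW) * avg (fun phi => best_fresh B phi rho w) + iW * avg (fun phi => fresh phi rho w o)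
  <= avg (fun phi => best_fresh (o :: B) phi rho w).
Proof.
move=> oB; pose Y phi := (Some o \notin (st phi rho w).2)%:R *
  Num.max 0 (gain phi rho w o - best_fresh B phi rho w).
have hY phi : Y phi <= Y (fupd phi o w).
  rewrite /Y; case: (boolP (Some o \in _)) => h /=; last first.
    by rewrite best_fresh_move // /gain state_move // h.
  by rewrite mul0r mulr_ge0 ?ler0n // le_max lexx.
have := avg_move hY => h1.
have h2 : avg (fun phi => best_fresh B phi rho w + (phi o == w)%:R * Y phi) <=
          avg (fun phi => best_fresh (o :: B) phi rho w).
  apply: avg_le => phi /=; rewrite /Y /fresh; have B0 := best_fresh_ge0 B phi rho w.
  case: (_ == w); rewrite ?mul1r ?mul0r ?addr0 ?le_max ?lexx //.
  case: (Some o \in _); rewrite /= ?mul1r ?mul0r ?addr0 ?lexx //.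
  by case: (leP 0 (gain phi rho w o - best_fresh B phi rho w)) => h; apply/orP; [right|left]; lra.
have h3 : avg (fun phi => fresh phi rho w o + (-1) * best_fresh B phi rho w) <= avg Y.
  apply: avg_le => phi; rewrite /Y /fresh; have B0 := best_fresh_ge0 B phi rho w.
  case: (Some o \in _); rewrite /= ?mul1r ?mul0r; first by lra.
  by rewrite mulN1r le_max lexx orbT.
move: h2 h3; rewrite !avgD avgZ => h2 h3.
have := ler_wpM2l (ltW iW_gt0) h3; move: h1 h2 => {h3}.
move: iW (avg (fun phi => best_fresh B phi rho w)) (avg (fun phi => fresh phi rho w o)) => i a b.
move: (avg Y) (avg (fun phi => best_fresh (o :: B) phi rho w)) (avg _) => c d z; lra.
Qed.

(** The factor [1 - size B / W] pays for several items of [B] falling into the same window, where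
    only the best one counts. *)
Lemma avg_best_fresh rho (w : 'I_W) (B : seq E) : uniq B ->
  iW * (1 - (size B)%:R * iW) * \sum_(o <- B) avg (fun phi => fresh phi rho w o)
  <= avg (fun phi => best_fresh B phi rho w).
Proof.
elim: B => [|o B IH] /=.
  by rewrite big_nil mulr0 avg_ge0.
case/andP=> oB uB; apply: le_trans (avg_best_fresh_cons rho w oB).
have := IH uB; rewrite big_cons.
set x := avg (fun phi => fresh phi rho w o); set y := \sum_(_ <- _) _.
set z := avg (fun phi => best_fresh B phi rho w) => h.
have x0 : 0 <= x by apply: avg_ge0 => phi; exact: fresh_ge0.
have y0 : 0 <= y by apply: sumr_ge0 => i _; apply: avg_ge0 => phi; exact: fresh_ge0.
have i0 := iW_gt0; have i1 := iW_le1.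
have b0 : 0 <= (size B)%:R :> R by rewrite ler0n.
have h' : (1 - iW) * (iW * (1 - (size B)%:R * iW) * y) <= (1 - iW) * z by rewrite ler_wpM2l // subr_ge0.
clearbody x y z; rewrite -[(size B).+1%:R]natr1; move: h' i0 i1 b0; move: iW (size B)%:R => i b h' i0 i1 b0.
suff : i * (1 - (b + 1) * i) * (x + y) <= (1 - i) * (i * (1 - b * i) * y) + i * x by lra.
have e1 : 0 <= i * i * i * b * y by rewrite !mulr_ge0 // ltW.
have e2 : 0 <= i * (i * (b + 1)) * x by rewrite !mulr_ge0 ?addr_ge0 ?ler01 ?(ltW i0).
nra.
Qed.

Lemma window_gain phi rho (w : 'I_W) :
  best_fresh (enum O) phi rho w <= fval phi rho w.+1 - fval phi rho w.
Proof.
have [h1 h2 _] := state_gain M fM kk0 (recheck rho) lok w (@windows_sub phi).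
have: {subset enum O <= O} by move=> o; rewrite mem_enum.
elim: (enum O) => [|o B IH] sub /=; first by rewrite subr_ge0.
rewrite ge_max IH /=; last by move=> x xB; apply: sub; rewrite inE xB orbT.
have oO : o \in O by apply: sub; rewrite mem_head.
case: eqP => [pw|_]; rewrite ?mul1r ?mul0r ?subr_ge0 // /fresh.
case: (_ \notin _); rewrite ?mul1r ?mul0r ?subr_ge0 // /gain lerD2r.
by apply: h2; rewrite mem_filter pw eqxx sU (subsetP OU).
Qed.

(** The selected items of [O] have distinct indices in [sel], at most [kk] in number. Such an index
    yields at least the gain of its item, and every other index yields at least [best_fresh]. *)
Lemma recheck_gain phi rho (w : 'I_W) :
  best_fresh (enum O) phi rho w * (1 - kk%:R * iW) +
    iW * \sum_(o in O) (gain phi rho w o - fresh phi rho w o)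
  <= avg (fun j => fval phi (fupd rho w j) w.+1) - fval phi rho w.
Proof.
have est j : st phi (fupd rho w j) w = st phi rho w.
  apply: eq_state => u uw; split=> //; rewrite /recheck ffunE; case: eqP => // e.
  by have := congr1 val e; rewrite /= inordK ?(ltn_trans uw) // => eu; rewrite eu ltnn in uw.
have eN j : best_fresh (enum O) phi (fupd rho w j) w = best_fresh (enum O) phi rho w.
  by elim: (enum O) => //= o B ->; rewrite /fresh /gain est.
set N := best_fresh _ _ _ _ in eN *.
pose sel := (st phi rho w).2.
pose g j := fval phi (fupd rho w j) w.+1 - fval phi rho w.
have gN j : N <= g j by rewrite -(eN j) /g -(est j) window_gain.
have gr (j : 'I_W) o : nth None sel j = Some o -> gain phi rho w o <= g j.
  move=> hj; have [_ _] := state_gain M fM kk0 (recheck (fupd rho w j)) lok w (@windows_sub phi).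
  have -> : recheck (fupd rho w j) w = j by rewrite /recheck inord_val ffunE eqxx.
  rewrite est -/sel hj /gain /g => h.
  by rewrite lerD2r.
have ssel : size sel = w by rewrite size_sel.
pose A := [set o in O | Some o \in sel].
have idx o : o \in A -> (index (Some o) sel < W)%N.
  rewrite inE => /andP[_]; rewrite -index_mem ssel => h; exact: ltn_trans h (ltn_ord w).
have hsum : \sum_(o in O) (gain phi rho w o - fresh phi rho w o) = \sum_(o in A) gain phi rho w o.
  rewrite [LHS](bigID [pred o | Some o \in sel]) /= [X in _ + X]big1 ?addr0.
    rewrite [RHS](eq_bigl (fun o => (o \in O) && (Some o \in sel))); last by move=> o; rewrite inE.
    by apply: eq_bigr => o /andP[_ h]; rewrite /fresh h mul0r subr0.
  by move=> o /andP[_ h]; rewrite /fresh h mul1r subrr.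
have hA : \sum_(o in A) (gain phi rho w o - N) <= \sum_j (g j - N).
  pose h o : 'I_W := inord (index (Some o) sel).
  have hnth o : o \in A -> nth None sel (h o) = Some o.
    by move=> oA; rewrite inordK ?idx // nth_index //; move: oA; rewrite inE => /andP[].
  have hinj : {in A &, injective h}.
    by move=> o o' oA o'A e; have := hnth _ oA; rewrite e hnth // => -[].
  apply: (@le_trans _ _ (\sum_(j in h @: A) (g j - N))).
    rewrite big_imset //=; apply: ler_sum => o oA; rewrite lerD2r.
    by apply: gr; exact: hnth.
  rewrite [leRHS](bigID [in h @: A]) /= lerDl sumr_ge0 // => j _; by rewrite subr_ge0.
have N0 : 0 <= N by exact: best_fresh_ge0.
have cA : #|A|%:R * N <= kk%:R * N.
  rewrite ler_wpM2r // ler_nat; apply: leq_trans (Ukk OU iO); apply: subset_leq_card.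
  by apply/subsetP=> o; rewrite inE => /andP[].
have -> : avg (fun j => fval phi (fupd rho w j) w.+1) - fval phi rho w = iW * \sum_j g j.
  rewrite /g sumrB sumr_const card_ord /avg card_ord mulrBr -[fval phi rho w *+ _]mulr_natl.
  by rewrite mulKf // pnatr_eq0.
rewrite hsum; clearbody g N; move: (gain phi rho w) hA => h hA.
have {}hA : \sum_(o in A) h o - kk%:R * N <= \sum_j g j - W%:R * N.
  by move: hA; rewrite !sumrB !sumr_const card_ord -![N *+ _]mulr_natl; lra.
have WN : iW * (W%:R * N) = N by rewrite mulrA mulVf ?mul1r // pnatr_eq0.
have := ler_wpM2l (ltW iW_gt0) hA; rewrite !mulrBr WN.
move: iW (\sum_(o in A) h o) (\sum_j g j) => i a b; lra.
Qed.

Definition mean w : R := avg (fun rho => avg (fun phi => fval phi rho w)).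

(** One factor [b] comes from fresh items sharing a window, the other from the indices that lead to
    rechecked items of [O]. *)
Lemma mean_step (w : 'I_W) (b := 1 - kk%:R * iW) :
  mean w + b ^+ 2 * iW * (f O - 2 * mean w) <= mean w.+1.
Proof.
have b0 : 0 <= b by rewrite subr_ge0 ler_pdivrMr ?ltr0n // mul1r ler_nat.
have b1 : b <= 1 by rewrite gerBl mulr_ge0 ?ler0n // ltW ?iW_gt0.
have i0 := iW_gt0.
pose g rho := avg (fun phi => \sum_(o in O) gain phi rho w o).
pose fr rho := avg (fun phi => \sum_(o in O) fresh phi rho w o).
pose N rho := avg (fun phi => best_fresh (enum O) phi rho w).
have hN rho : iW * b * fr rho <= N rho.
  apply: le_trans (avg_best_fresh rho w (enum_uniq O)).
  rewrite big_enum /= -avg_sum -/(fr rho).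
  have fr0 : 0 <= fr rho by apply: avg_ge0 => phi; apply: sumr_ge0 => o _; exact: fresh_ge0.
  rewrite ler_wpM2r // ler_wpM2l ?(ltW i0) // lerD2l lerN2 ler_wpM2r ?(ltW i0) // ler_nat.
  by rewrite -cardE; exact: Ukk.
have hstep : avg (fun rho => N rho * b + iW * (g rho - fr rho)) <= mean w.+1 - mean w.
  rewrite /mean (avg_resample w (fun rho => avg (fun phi => fval phi rho w.+1))) ?card_ord //.
  rewrite -avgB; apply: avg_le => rho; cbv beta.
  rewrite (avg_exchange (fun j phi => fval phi (fupd rho w j) w.+1)) -avgB.
  have -> : N rho * b + iW * (g rho - fr rho) =
    avg (fun phi => best_fresh (enum O) phi rho w * b + iW * \sum_(o in O) (gain phi rho w o - fresh phi rho w o)).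
    rewrite avgD (avgZ iW) (eq_avg (G := fun phi => b * best_fresh (enum O) phi rho w)); last by move=> phi; rewrite mulrC.
    rewrite avgZ -/(N rho) mulrC; congr (_ + _ * _).
    by rewrite /g /fr -avgB; apply: eq_avg => phi; rewrite -sumrB.
  by apply: avg_le => phi; exact: recheck_gain.
have hg : f O - 2 * mean w <= avg g.
  have Rcard : (0 < #|{ffun 'I_W -> 'I_W}|)%N by rewrite card_ffun !card_ord expn_gt0.
  have Pcard : (0 < #|{ffun E -> 'I_W}|)%N by rewrite card_ffun !card_ord expn_gt0.
  rewrite -[f O](avg_const (f O) Rcard) /mean -mulNr -avgZ -avgD; apply: avg_le => rho.
  rewrite -[f O](avg_const (f O) Pcard) -avgZ -avgD; apply: avg_le => phi.
  rewrite mulNr.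
  exact: (state_swap_gains f0 fM fS kk0 (recheck rho) lok w (@windows_sub phi) Ukk OU iO).
have fg rho : 0 <= fr rho <= g rho.
  rewrite avg_ge0 => [|phi]; last by apply: sumr_ge0 => o _; exact: fresh_ge0.
  apply: avg_le => phi; apply: ler_sum => o _; rewrite /fresh.
  by case: (_ \notin _); rewrite ?mul1r ?mul0r // gain_ge0.
rewrite -lerBrDl.
have : b ^+ 2 * iW * avg g <= mean w.+1 - mean w.
  apply: le_trans hstep; rewrite -avgZ; apply: avg_le => rho.
  have /andP[fr0 frg] := fg rho.
  have h1 : iW * b * fr rho * b <= N rho * b by rewrite ler_wpM2r.
  have h2 : 0 <= (1 - b ^+ 2) * (iW * (g rho - fr rho)).
    by rewrite mulr_ge0 ?subr_ge0 ?exprn_ile1 // mulr_ge0 ?subr_ge0 // ltW.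
  move: h1 h2; rewrite expr2; move: iW (fr rho) (g rho) (N rho) => i a c d; nra.
have : b ^+ 2 * iW * (f O - 2 * mean w) <= b ^+ 2 * iW * avg g.
  by rewrite ler_wpM2l // mulr_ge0 ?exprn_ge0 // ltW.
exact: le_trans.
Qed.

(** The distance from [mean w] to [f O / 2] shrinks by the factor [1 - 2 a / W] in every window, and
    [W] such factors are at most [expR (- (2 a))]. The hypothesis on [W] makes the factor
    nonnegative. *)
Lemma mean_final (a : R := (1 - kk%:R * iW) ^+ 2) : 2 * iW <= 1 ->
  2^-1 * (1 - expR (- (2 * a))) * f O <= mean W.
Proof.
move=> W2.
have i0 := iW_gt0.
have a1 : 0 <= a <= 1.
  have b0 : 0 <= 1 - kk%:R * iW by rewrite subr_ge0 ler_pdivrMr ?ltr0n // mul1r ler_nat.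
  have b1 : 1 - kk%:R * iW <= 1 by rewrite gerBl mulr_ge0 ?ler0n // ltW.
  by rewrite exprn_ge0 // exprn_ile1.
have c0 : 0 <= 1 - 2 * a * iW.
  by move: a1 W2 i0; move: a iW => b i; nra.
have H w : (w <= W)%N -> f O / 2 - mean w <= (1 - 2 * a * iW) ^+ w * (f O / 2).
  elim: w => [|w IH] lew.
    rewrite expr0 mul1r gerBl; apply: avg_ge0 => rho; apply: avg_ge0 => phi; exact: f0.
  have {}IH := IH (ltnW lew).
  have hs : mean w + a * iW * (f O - 2 * mean w) <= mean w.+1 := mean_step (Ordinal lew).
  rewrite exprS -mulrA; apply: le_trans (ler_wpM2l c0 IH).
  move: hs; clearbody a; move: iW (mean w) (mean w.+1) => i x y; lra.
have := H W (leqnn _).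
have : (1 - 2 * a * iW) ^+ W <= expR (- (2 * a)).
  have -> : expR (- (2 * a)) = expR (- (2 * a * iW)) ^+ W.
    by rewrite -expRM_natl; congr expR; rewrite mulrN [W%:R * _]mulrC divfK // pnatr_eq0.
  by rewrite lerXn2r ?nnegrE ?expR_ge0 // expR_ge1Dx.
move=> he /le_trans => /(_ (expR (- (2 * a)) * (f O / 2))) => h.
have : f O / 2 - mean W <= expR (- (2 * a)) * (f O / 2).
  by apply: h; rewrite ler_wpM2r // divr_ge0.
lra.
Qed.

End Drift.

(** * Records in a random order *)

Section Records.
Variables (R : realType) (E T : eqType) (k : T -> R * nat) (o : E -> T) (b : T).
Implicit Types (z u s : seq E) (x y : E).

Definition leader z := fmax k b (map o z).
Definition record z x := ~~ lexle (k (o x)) (k (leader z)).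

(* [m] is the size of the window: the items at positions [i] with [B (i + 1) <= m]
   are only observed, and at most [L] records are kept after that. *)
Definition keep_step (B L m : nat) (p : nat * T * seq E) x : nat * T * seq E :=
  let r := ~~ lexle (k (o x)) (k p.1.2) in
  (p.1.1.+1, challenge k p.1.2 (o x),
   if [&& r, (m < B * p.1.1.+1)%N & (size p.2 < L)%N] then rcons p.2 x else p.2).

Definition keep B L m z := foldl (keep_step B L m) (0%N, b, [::]) z.

(** Recursion on the reversed list compares each item with the leader of those before it. *)
Fixpoint records_rev (r : nat) z : nat :=
  if z is x :: z' then (records_rev r z' + ((r <= size z')%N && record (rev z') x))%N else 0%N.
Definition records r z := records_rev r (rev z).

Lemma records_rcons r z x :
  records r (rcons z x) = (records r z + ((r <= size z)%N && record z x))%N.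
Proof. by rewrite /records rev_rcons /= size_rev revK. Qed.

Lemma records_small r z : (size z <= r)%N -> records r z = 0%N.
Proof.
elim/last_ind: z => // z x IH; rewrite size_rcons records_rcons => h.
by rewrite IH ?(ltnW h) // leqNgt h.
Qed.

Lemma keep_leader B L m z : (keep B L m z).1 = (size z, leader z).
Proof.
elim/last_ind: z => // z x; rewrite /keep /leader foldl_rcons map_rcons fmax_rcons size_rcons.
by move=> /= -> /=.
Qed.

Lemma keep_rcons B L m z x : (keep B L m (rcons z x)).2 =
  if [&& record z x, (m < B * (size z).+1)%N & (size (keep B L m z).2 < L)%N]
  then rcons (keep B L m z).2 x else (keep B L m z).2.
Proof. by rewrite {1}/keep foldl_rcons /= -/(keep B L m z) keep_leader. Qed.

Lemma size_keep_le B L m z : (size (keep B L m z).2 <= L)%N.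
Proof.
elim/last_ind: z => // z x IH; rewrite keep_rcons; case: ifP => // /and3P[_ _ h].
by rewrite size_rcons.
Qed.

Lemma size_keep_records B L m z : (0 < B)%N ->
  (size (keep B L m z).2 <= records (m %/ B) z)%N.
Proof.
move=> B0; elim/last_ind: z => // z x IH; rewrite keep_rcons records_rcons.
have -> : (m < B * (size z).+1)%N = (m %/ B <= size z)%N by rewrite mulnC -ltn_divLR.
case: ifP => [/and3P[-> -> _]|_]; last exact: leq_trans IH (leq_addr _ _).
by rewrite size_rcons addn1.
Qed.

Lemma keep_cat B L m z1 z2 : {subset (keep B L m z1).2 <= (keep B L m (z1 ++ z2)).2}.
Proof.
elim/last_ind: z2 => [|z2 x IH] y yz; first by rewrite cats0.
rewrite -rcons_cat keep_rcons; have yI := IH y yz.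
by case: ifP => _ //; rewrite mem_rcons inE yI orbT.
Qed.

Lemma records_cat r z1 z2 : (records r z1 <= records r (z1 ++ z2))%N.
Proof.
elim/last_ind: z2 => [|z2 x IH]; first by rewrite cats0.
by rewrite -rcons_cat records_rcons; apply: leq_trans IH (leq_addr _ _).
Qed.

Lemma record_top z x : record z x -> all (fun y => ~~ lexle (k (o x)) (k (o y))) z.
Proof.
move=> h; apply/allP => y yz; apply: contra h => /lexle_trans; apply.
by apply: fmax_ge; rewrite inE map_f ?orbT.
Qed.

Lemma perm_top u x s : perm_eq s (rem x u) ->
  record s x -> all (fun y => ~~ lexle (k (o x)) (k (o y))) (rem x u).
Proof. by move=> /perm_all <- /record_top. Qed.

Lemma count_top u : uniq u ->
  (count (fun x => all (fun y => ~~ lexle (k (o x)) (k (o y))) (rem x u)) u <= 1)%N.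
Proof.
move=> uu; rewrite leqNgt -size_filter; apply/negP.
set v := filter _ u => hv.
have uv : uniq v by rewrite filter_uniq.
case ev : v hv uv => [|x [|y v']] //= _; rewrite inE negb_or => /andP[/andP[xy _] _].
have := mem_head x (y :: v'); rewrite -ev mem_filter => /andP[/allP hx xu].
have : y \in v by rewrite ev !inE eqxx orbT.
rewrite mem_filter => /andP[/allP hy yu].
have := hx y; rewrite mem_rem_uniq // inE [y == x]eq_sym xy yu => /(_ isT).
have := hy x; rewrite mem_rem_uniq // inE xy xu => /(_ isT).
by have := lexle_total (k (o x)) (k (o y)) => /orP[->|->].
Qed.

(* The last item of a random order of [u] is a record with probability at most
   [1 / size u], independently of the order of the others, so the bound telescopes. *)
Lemma pavg_pow_records r u : uniq u -> (r <= size u)%N ->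
  pavg u (fun s => (2 : R) ^+ records r s) <= (size u).+1%:R / r.+1%:R.
Proof.
move: {2}(size u) (erefl (size u)) => j; elim: j u => [|j IH] u su uu ru.
  have -> : r = 0%N by lia.
  rewrite su divr1 (eq_pavg (G := fun=> 1)) ?pavg_const // => s /perm_size; rewrite su => /size0nil ->.
  by rewrite /records /= expr0.
have [er|ner] := eqVneq r j.+1.
  rewrite su er divff ?pnatr_eq0 // (eq_pavg (G := fun=> 1)) ?pavg_const // => s /perm_size; rewrite su => ss.
  by rewrite records_small ?ss ?expr0.
have rj : (r <= j)%N by lia.
have un : u != [::] by case: (u) su.
rewrite pavg_rcons // su.
pose top x := all (fun y => ~~ lexle (k (o x)) (k (o y))) (rem x u).
pose C : R := j.+1%:R / r.+1%:R.
have C0 : 0 <= C by rewrite divr_ge0 ?ler0n.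
(* A last item that is a record doubles the power, and at most one item of [u] can be one, so the
   mean grows by the factor [(j + 2) / (j + 1)] at most. *)
have hx x : x \in u -> pavg (rem x u) (fun s => (2 : R) ^+ records r (rcons s x)) <=
    C + (top x)%:R * C.
  move=> xu; have sr : size (rem x u) = j by rewrite size_rem // su.
  apply: (@le_trans _ _ (pavg (rem x u) (fun s => (1 + (top x)%:R) * (2 : R) ^+ records r s))).
    apply: pavg_le => s ps; rewrite records_rcons exprD mulrC ler_wpM2r ?exprn_ge0 //.
    case: (boolP (record s x)) => [/(perm_top ps) ht|_].
      by rewrite /top ht andbT; case: (r <= _)%N; rewrite ?expr1 ?expr0 // lerDl.
    by rewrite andbF expr0 lerDl ler0n.
  rewrite pavgZ mulrDl mul1r; have := IH _ sr (rem_uniq x uu); rewrite sr => /(_ rj) h.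
  by apply: lerD => //; rewrite ler_wpM2l ?ler0n.
have h : \sum_(x <- u) pavg (rem x u) (fun s => (2 : R) ^+ records r (rcons s x)) <= j.+2%:R * C.
  apply: (@le_trans _ _ (\sum_(x <- u) (C + (top x)%:R * C))).
    by rewrite big_seq [leRHS]big_seq; apply: ler_sum.
  rewrite big_split /= big_const_seq count_predT iter_addr_0 su -mulr_suml -[C *+ _]mulr_natl -mulrDl.
  rewrite ler_wpM2r // -[j.+2%:R]natr1 lerD2l.
  rewrite -natr_sum (eq_bigr (fun x => if top x then 1%N else 0%N)); last by move=> x _; case: (top x).
  by rewrite -big_mkcond sum1_count lern1 count_top.
rewrite -ler_pdivlMl ?invr_gt0 ?ltr0n // invrK in h *.
by apply: le_trans h _; rewrite /C mulrCA.
Qed.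

Lemma pavg_index r u x : uniq u -> x \in u -> (r <= size u)%N ->
  pavg u (fun s => ((index x s < r)%N)%:R : R) <= r%:R / (size u)%:R.
Proof.
move: {2}(size u) (erefl (size u)) => j; elim: j u => [|j IH] u su uu xu ru.
  by case: (u) su xu.
have [er|ner] := eqVneq r j.+1.
  rewrite su er divff ?pnatr_eq0 // -[leRHS](pavg_const u 1); apply: pavg_le => s _.
  by case: (_ < _)%N.
have rj : (r <= j)%N by lia.
have un : u != [::] by case: (u) su.
rewrite pavg_rcons // su mulrC ler_wpM2r ?invr_ge0 ?ler0n //.
rewrite (big_rem x) //= (eq_pavg (G := fun=> 0)); last first.
  move=> s ps; rewrite -cats1 index_cat (perm_mem ps) mem_rem_uniq // inE eqxx /= eqxx addn0.
  by rewrite (perm_size ps) size_rem // su ltnNge rj.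
rewrite pavg_const add0r.
apply: (@le_trans _ _ (\sum_(y <- rem x u) r%:R / j%:R)).
  rewrite big_seq [leRHS]big_seq; apply: ler_sum => y; rewrite mem_rem_uniq // inE => /andP[yx yu].
  have sr : size (rem y u) = j by rewrite size_rem // su.
  have xr : x \in rem y u by rewrite mem_rem_uniq // inE eq_sym yx.
  have := IH _ sr (rem_uniq y uu) xr; rewrite sr => /(_ rj); apply: le_trans.
  apply: pavg_le => s ps; rewrite -cats1 index_cat (perm_mem ps) xr //.
rewrite big_const_seq count_predT iter_addr_0 size_rem // su /= -[(_ / _) *+ _]mulr_natl.
have [->|j0] := posnP j; first by rewrite mulr0n mul0r ler0n.
by rewrite mulrCA divff ?mulr1 // pnatr_eq0 -lt0n.
Qed.

(** The best item of a window is a record wherever it stands. If it comes after the observed items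
    and is not kept, then [L] records were kept before it, and it is one more. *)
Lemma missed_record B L u x s : (0 < B)%N -> uniq u -> x \in u ->
  {in u &, injective (fun y => k (o y))} ->
  leader u = o x -> ~~ lexle (k (o x)) (k b) -> perm_eq s u ->
  x \notin (keep B L (size u) s).2 ->
  (index x s < size u %/ B)%N \/ (L < records (size u %/ B) s)%N.
Proof.
move=> B0 uu xu inj lu xb su.
have xs : x \in s by rewrite (perm_mem su).
have us : uniq s by rewrite (perm_uniq su).
case: (ltnP (index x s) (size u %/ B)) => [|hr]; first by left.
have [s1 [s2 es]] : exists s1 s2, s = s1 ++ x :: s2 by case/splitPr: xs => s1 s2; exists s1, s2.
rewrite {1}es => xk; right.
have xs1 : x \notin s1 by move: us; rewrite es cat_uniq /= => /and3P[_ /norP[]].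
have ix : index x s = size s1 by rewrite es index_cat (negPf xs1) /= eqxx addn0.
have rx : record s1 x.
  rewrite /record /leader; have := fmax_mem k b (map o s1); rewrite inE => /orP[/eqP->//|].
  move=> /mapP[y ys1 ey]; rewrite ey; apply/negP => hxy.
  have yu : y \in u by rewrite -(perm_mem su) es mem_cat ys1.
  have hyx : lexle (k (o y)) (k (o x)) by rewrite -lu; apply: fmax_ge; rewrite inE map_f ?orbT.
  by have := inj _ _ xu yu (lexle_anti hxy hyx) => exy; rewrite exy ys1 in xs1.
have hm : (size u < B * (size s1).+1)%N by rewrite mulnC -ltn_divLR // -ix.
have hL : (L <= size (keep B L (size u) s1).2)%N.
  rewrite leqNgt; apply: contra xk => lt; rewrite -cat_rcons; apply: keep_cat.
  by rewrite keep_rcons rx hm lt mem_rcons mem_head.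
rewrite es -cat_rcons; apply: leq_trans (records_cat _ _ _).
rewrite records_rcons rx andbT -ix hr addn1 ltnS.
exact: leq_trans hL (size_keep_records _ _ _ B0).
Qed.

(** The first term is the chance of standing among the observed items. The second is Markov's
    inequality for [2 ^ records], whose mean is at most [(size u + 1) / (r + 1) <= B]. *)
Lemma miss_probability B L u x : (0 < B)%N -> uniq u -> x \in u ->
  {in u &, injective (fun y => k (o y))} ->
  leader u = o x -> ~~ lexle (k (o x)) (k b) ->
  pavg u (fun s => (x \notin (keep B L (size u) s).2)%:R) <= B%:R^-1 + B%:R / 2 ^+ L.+1 :> R.
Proof.
move=> B0 uu xu inj lu xb; set r := (size u %/ B)%N.
have ru : (r <= size u)%N by exact: leq_div.
have u0 : (0 < size u)%N by case: (u) xu.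
apply: (@le_trans _ _ (pavg u (fun s => ((index x s < r)%N)%:R + (2 ^+ L.+1)^-1 * 2 ^+ records r s))).
  apply: pavg_le => s su; case: (boolP (x \in _)) => [_|xk] /=.
    by rewrite addr_ge0 ?ler0n // mulr_ge0 ?invr_ge0 ?exprn_ge0.
  have p0 : 0 <= (2 ^+ L.+1)^-1 * 2 ^+ records r s :> R by rewrite mulr_ge0 ?invr_ge0 ?exprn_ge0.
  have [-> |hL] := missed_record B0 uu xu inj lu xb su xk; first by rewrite lerDl.
  rewrite -[leLHS]add0r lerD ?ler0n // -ler_pdivrMl ?invr_gt0 ?exprn_gt0 // invrK mulr1.
  by rewrite ler_weXn2l // ler1n.
rewrite pavgD pavgZ; apply: lerD.
  apply: le_trans (pavg_index uu xu ru) _.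
  rewrite ler_pdivrMr ?ltr0n // mulrC ler_pdivlMr ?ltr0n // -natrM ler_nat; exact: leq_trunc_div.
rewrite mulrC ler_wpM2r ?invr_ge0 ?exprn_ge0 //; apply: le_trans (pavg_pow_records uu ru) _.
rewrite ler_pdivrMr ?ltr0n // -natrM ler_nat mulnC -ltn_divLR //.
Qed.

End Records.

(** * Value of the shortlisted part of the selected set *)

(** The events may be dependent: a present item adds to the present part of the others at least its
    marginal over all the others, so only the individual miss probabilities enter. *)
Lemma sampled_value (R : realType) (E : finType) (f : {set E} -> R) (u : seq E)
    (A : seq E -> {set E}) (d : R) (S : {set E}) :
  nonnegative f -> monotone f -> submodular f -> 0 <= d ->
  (forall x, x \in S -> pavg u (fun s => (x \notin A s)%:R) <= d) ->
  (1 - d) * f S <= pavg u (fun s => f (S :&: A s)).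
Proof.
move=> f0 fM fS d0 hd.
(* Splitting off [f set0] makes the empty case exact; each further item then contributes [1 - d]
   times its marginal. *)
suff : f set0 + (1 - d) * (f S - f set0) <= pavg u (fun s => f (S :&: A s)).
  by apply: le_trans; have := mulr_ge0 d0 (f0 set0); lra.
move: {2}#|S| (erefl #|S|) => j; elim: j S hd => [|j IH] S hd cS.
  rewrite (cards0_eq cS) subrr mulr0 addr0 -[leLHS](pavg_const u); apply: pavg_le => s _.
  by rewrite set0I.
have [x xS] : exists x, x \in S by apply/set0Pn; rewrite -card_gt0 cS.
have hS' y : y \in S :\ x -> pavg u (fun s => (y \notin A s)%:R) <= d.
  by rewrite inE => /andP[_ /hd].
have {IH} h := IH _ hS' (card_setD1 xS cS).
have g0 : 0 <= f S - f (S :\ x) by rewrite subr_ge0 fM // subsetDl.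
have : pavg u (fun s => f ((S :\ x) :&: A s) + (1 + (-1) * (x \notin A s)%:R) * (f S - f (S :\ x))) <=
       pavg u (fun s => f (S :&: A s)).
  apply: pavg_le => s _; case: (boolP (x \in A s)) => xA /=; last first.
    by rewrite mulr1 subrr mul0r addr0 fM // setSI // subsetDl.
  rewrite mulr0 addr0 mul1r.
  have xn : x \notin S :\ x by rewrite !inE eqxx.
  have := submodular_marginal fS (subsetIl (S :\ x) (A s)) xn.
  have -> : x |: (S :\ x) :&: A s = S :&: A s.
    by apply/setP => y; rewrite !inE; have [->|//] := eqVneq y x; rewrite xS xA.
  rewrite setD1K //; lra.
rewrite pavgD (eq_pavg (G := fun s => (f S - f (S :\ x)) * (1 + (-1) * (x \notin A s)%:R))
   (u := u) (F := fun s => (1 + _) * _)); last by move=> s _; rewrite mulrC.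
rewrite pavgZ pavgD pavgZ pavg_const.
have := ler_wpM2l g0 (hd x xS); move: h.
move: (pavg u (fun s => (x \notin A s)%:R)) (pavg u (fun s => f (S :&: A s))) => p q.
move: (pavg u _) => q'; lra.
Qed.

Section Shortlist.
Variables (R : realType) (E : finType) (M : matroid E) (f : {set E} -> R).
Variables (kk K B L : nat).
Implicit Types (zs : nat -> seq E) (lam : E -> nat) (rho : nat -> nat).

Definition kept lam (S : seq (option E)) (z : seq E) : seq E :=
  (keep fst (fun x => offer M f kk S (Some x) (lam x)) (idle f K S) B L (size z) z).2.

Fixpoint shortset lam rho zs w : {set E} :=
  if w is w'.+1 then
    shortset lam rho zs w' :|: [set x in kept lam (state M f kk K lam rho zs w').1 (zs w')]
  else set0.

Lemma card_shortset lam rho zs w : (#|shortset lam rho zs w| <= w * L)%N.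
Proof.
elim: w => [|w IH] /=; first by rewrite cards0.
rewrite cardsU mulSn addnC; apply: leq_trans (leq_subr _ _) _; apply: leq_add => //.
by rewrite cardsE; apply: leq_trans (card_size _) _; exact: size_keep_le.
Qed.

Lemma in_shortset lam rho zs w u x : (u < w)%N ->
  x \in kept lam (state M f kk K lam rho zs u).1 (zs u) -> x \in shortset lam rho zs w.
Proof.
elim: w => //= w IH; rewrite ltnS leq_eqVlt => /orP[/eqP->|uw] h; rewrite !inE.
  by rewrite h orbT.
by rewrite IH.
Qed.

(** Distinct keys make the winner of a window a function of the set of its items. *)
Lemma eq_mem_state (U : {set E}) lam rho zs zs' w : {in U &, injective lam} ->
  (forall u, {subset zs u <= U}) -> (forall u, zs u =i zs' u) ->
  state M f kk K lam rho zs w = state M f kk K lam rho zs' w.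
Proof.
move=> inj sub hz; elim: w => //= w ->; rewrite /window_best !fmax_rcons.
suff -> : forall S, fmax fst (idle f K S) (offers M f kk S lam (zs w)) =
  fmax fst (idle f K S) (offers M f kk S lam (zs' w)) by [].
move=> S; apply: eq_mem_fmax.
  by move=> t; apply/mapP/mapP => -[x xz ->]; exists x => //; rewrite ?hz // -hz.
move=> _ _ /mapP[x xz ->] /mapP[y yz ->] [_ /=].
by move/(inj _ _ (sub _ _ xz) (sub _ _ yz)) ->.
Qed.

Hypotheses (f0 : nonnegative f) (fM : monotone f) (fS : submodular f).
Hypotheses (kk0 : (0 < kk)%N) (B0 : (0 < B)%N).

(** The state is the same for every order with the windows of [phi]. Each of its items was the best
    of some window [u], so its miss probability concerns the order inside that window alone. *)
Lemma shortset_value (U : {set E}) lam rho W (phi : {ffun E -> 'I_W.+1}) w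
    (d : R := B%:R^-1 + B%:R / 2 ^+ L.+1)
    (st := fun s => state M f kk K lam rho (windows s phi) w) :
  (forall x, (lam x < K)%N) -> {in U &, injective lam} ->
  (1 - d) * f (items (st (enum U)).1) <=
  pavg (enum U) (fun s => f (items (st s).1 :&: shortset lam rho (windows s phi) w)).
Proof.
move=> lok inj.
have mem_w s u : perm_eq s (enum U) -> windows s phi u =i windows (enum U) phi u.
  by move=> ps x; rewrite !(mem_filter (fun y => val (phi y) == u)) (perm_mem ps).
have sub u : {subset windows (enum U) phi u <= U}.
  by move=> x; rewrite /windows mem_filter mem_enum => /andP[].
have est s u : perm_eq s (enum U) ->
    state M f kk K lam rho (windows s phi) u = state M f kk K lam rho (windows (enum U) phi) u.
  move=> ps; apply/esym/(eq_mem_state rho u inj sub) => v x.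
  by rewrite mem_w.
rewrite (eq_pavg (G := fun s => f (items (st (enum U)).1 :&: shortset lam rho (windows s phi) w))); last first.
  by move=> s ps; rewrite /st est.
have d0 : 0 <= d by rewrite addr_ge0 ?invr_ge0 ?ler0n // divr_ge0 ?ler0n ?exprn_ge0.
apply: sampled_value => // x; rewrite in_items => xS.
have [_ _ _ hS _] := state_ok M fM kk0 rho lok w sub.
have [u [uw xu] [hl hb]] := sel_first fM kk0 lok sub (hS _ xS).
set S := (state M f kk K lam rho (windows (enum U) phi) u).1 in hl hb.
pose z0 := windows (enum U) phi u.
pose G z : R := (x \notin (keep fst (fun x => offer M f kk S (Some x) (lam x)) (idle f K S) B L (size z0) z).2)%:R.
apply: (@le_trans _ _ (pavg (enum U) (fun s => G (filter (fun y => val (phi y) == u) s)))).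
  apply: pavg_le => s ps; rewrite /G.
  case: (boolP (x \in (keep _ _ _ _ _ _ _).2)) => [xk|_]; last by case: (x \in _).
  rewrite (in_shortset uw) // /kept est // -/S.
  suff -> : size (windows s phi u) = size z0 by [].
  by apply: perm_size; exact: perm_filter.
rewrite (pavg_filter _ G) ?enum_uniq //; apply: miss_probability => //.
- by rewrite filter_uniq ?enum_uniq.
- by move=> y z yz zz [_]; apply: inj; apply: sub; [exact: yz|exact: zz].
Qed.

End Shortlist.

(** Union bound over the pairs of items. *)
Lemma collision_probability (R : realType) (E : finType) (U : {set E}) K :
  1 - (#|U| ^ 2)%:R / K.+1%:R <=
  avg (fun l : {ffun E -> 'I_K.+1} => [forall x in U, forall y in U, (l x == l y) ==> (x == y)]%:R) :> R.
Proof.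
have c0 : (0 < #|{ffun E -> 'I_K.+1}|)%N by rewrite card_ffun card_ord expn_gt0.
have hxy x y : x != y -> avg (fun l : {ffun E -> 'I_K.+1} => (l x == l y)%:R : R) = K.+1%:R^-1.
  move=> xy; rewrite (avg_resample x) ?card_ord //.
  rewrite (eq_avg (G := fun=> K.+1%:R^-1)) ?avg_const // => l.
  rewrite /avg card_ord (bigD1 (l y)) //= !ffunE eqxx [y == x]eq_sym (negPf xy) eqxx big1 ?addr0 ?mulr1 //.
  by move=> j jl; rewrite !ffunE eqxx [y == x]eq_sym (negPf xy) (negPf jl).
apply: (@le_trans _ _ (avg (fun l : {ffun E -> 'I_K.+1} =>
   1 - \sum_(x in U) \sum_(y in U | x != y) (l x == l y)%:R))).
  rewrite avgB avg_const // avg_sum lerD2l lerN2.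
  apply: (@le_trans _ _ (\sum_(x in U) \sum_(y in U) K.+1%:R^-1)).
    apply: ler_sum => x xU; rewrite avg_sum [leRHS](bigID (fun y => x != y)) /=.
    rewrite (eq_bigr (fun=> K.+1%:R^-1)) => [|y /andP[_ /hxy //]].
    by rewrite lerDl sumr_ge0 // => y _; rewrite invr_ge0.
  by rewrite !sumr_const -mulrnA mulnn -[_^-1 *+ _]mulr_natl.
apply: avg_le => l; case: (boolP [forall x in U, _]) => [_|].
  by rewrite gerBl sumr_ge0 // => x _; rewrite sumr_ge0.
case/forall_inPn => x xU /forall_inPn[y yU]; rewrite negb_imply => /andP[lxy xy].
rewrite subr_le0 (bigD1 x) //= (bigD1 y) ?yU ?xy //= lxy.
by rewrite -addrA lerDl addr_ge0 ?sumr_ge0 // => ? _; rewrite sumr_ge0.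
Qed.

(** * From arrival orders to uniform maps *)

(** The stable sort of [l] by [g], cut into its classes. *)
Definition blocks (T : eqType) (g : T -> nat) W (l : seq T) : seq (seq T) :=
  [seq [seq x <- l | g x == w] | w <- iota 0 W].

Lemma perm_blocks (T : eqType) (g : T -> nat) W (l : seq T) :
  all (fun x => g x < W)%N l -> perm_eq (flatten (blocks g W l)) l.
Proof.
move=> /all_filterP {2}<-; elim: W => [|W IH]; first by rewrite /= filter_pred0.
rewrite /blocks -[W.+1]addn1 iotaD map_cat flatten_cat /= cats0 add0n.
rewrite perm_sym -(perm_filterC (fun x => g x < W)%N) perm_sym -!filter_predI.
apply: perm_cat; [rewrite (permPl IH)|]; apply/permP => a; congr count; apply: eq_filter => x /=; lia.
Qed.

Lemma blocks_map (S T : eqType) (h : S -> T) (g : T -> nat) W (l : seq S) :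
  blocks g W (map h l) = [seq map h z | z <- blocks (g \o h) W l].
Proof. by rewrite /blocks -map_comp; apply: eq_map => w /=; rewrite filter_map. Qed.

Section Rearrange.
Variables (R : realType) (E : finType) (M : matroid E) (f : {set E} -> R).
Variables (kk K B L Wm : nat).
Local Notation W := Wm.+1.

Lemma eq_run lam lam' rho rho' (zs zs' : nat -> seq E) w :
  (forall u, (u < w)%N -> [/\ zs u = zs' u, rho u = rho' u & {in zs u, lam =1 lam'}]) ->
  state M f kk K lam rho zs w = state M f kk K lam' rho' zs' w /\
  shortset M f kk K B L lam rho zs w = shortset M f kk K B L lam' rho' zs' w.
Proof.
elim: w => //= w IH h; have [|-> ->] := IH.
  by move=> u uw; apply: h; rewrite ltnS ltnW.
have [<- <- el] := h w (ltnSn w).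
have eo S : offers M f kk S lam (zs w) = offers M f kk S lam' (zs w).
  by apply/eq_in_map => x xz; rewrite el.
have ek S : kept M f kk K B L lam S (zs w) = kept M f kk K B L lam' S (zs w).
  rewrite /kept /keep; move: (size (zs w)) (0%N, _, _) => m; elim: (zs w) el => //= x z IHz el p.
  rewrite IHz => [|y yz]; last by apply: el; rewrite inE yz orbT.
  by rewrite /keep_step /= el ?mem_head.
by rewrite /window_best eo ek.
Qed.

(** The program uses only how often each window index was drawn, and cuts the arrival order into
    consecutive pieces of these sizes. *)
Definition prog_windows (a : seq E) (d : seq nat) u : seq E :=
  nth [::] (reshape [seq count_mem w d | w <- iota 0 W] a) u.
Definition prog_keys (a : seq E) (v : seq nat) x : nat := nth 0%N v (index x a).

Definition prog_value a d v r : R :=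
  let lam := prog_keys a v in let zs := prog_windows a d in
  f (items (state M f kk K lam (nth 0%N r) zs W).1 :&: shortset M f kk K B L lam (nth 0%N r) zs W).

Definition model_value (s : seq E) (phi : {ffun E -> 'I_W}) (lam : E -> nat)
    (rho : {ffun 'I_W -> 'I_W}) : R :=
  f (items (state M f kk K lam (recheck rho) (windows s phi) W).1 :&:
     shortset M f kk K B L lam (recheck rho) (windows s phi) W).

(** The numbers of occurrences of the values of [phi] are the sizes of the blocks of [a], so cutting
    [a] recovers these blocks. *)
Lemma prog_value_model s (phi : {ffun E -> 'I_W}) (lam : E -> nat) (rho : {ffun 'I_W -> 'I_W})
    (a := flatten (blocks (fun x => val (phi x)) W s)) :
  prog_value a [seq val (phi x) | x <- s] (map lam a) [seq val (rho i) | i <- enum 'I_W] =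
  model_value s phi lam rho.
Proof.
have ez u : (u < W)%N -> prog_windows a [seq val (phi x) | x <- s] u = windows s phi u.
  move=> uW; rewrite /prog_windows.
  have -> : [seq count_mem w [seq val (phi x) | x <- s] | w <- iota 0 W] =
            shape (blocks (fun x => val (phi x)) W s).
    by rewrite /shape -map_comp; apply: eq_map => w /=; rewrite count_map size_filter.
  by rewrite flattenK (nth_map 0%N) ?size_iota // nth_iota.
rewrite /prog_value /model_value.
have [|-> ->] // := eq_run (lam := prog_keys a (map lam a)) (lam' := lam)
  (rho := nth 0%N [seq val (rho i) | i <- enum 'I_W]) (rho' := recheck rho)
  (zs := prog_windows a [seq val (phi x) | x <- s]) (zs' := windows s phi) (w := W).
move=> u uW; split; first exact: ez.
  rewrite (nth_map ord0) ?size_enum_ord // /recheck; congr (val (rho _)).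
  by apply: val_inj; rewrite /= nth_enum_ord // inordK.
rewrite ez // => x xu; rewrite /prog_keys; have xa : x \in a.
  apply/flattenP; exists (windows s phi u) => //.
  by apply/mapP; exists u => //; rewrite mem_iota.
by rewrite (nth_map x) ?index_mem // nth_index.
Qed.

(* Sorting the arrival positions by their draws is a bijection on arrival orders, so
   the windows cut from a uniform order are distributed as those of a uniform [phi]. *)
Lemma avg_prog_value (U : {set E}) Km :
  pavg (enum U) (fun a => avgseq Wm #|U| (fun d => avgseq Km #|U| (fun v =>
    avgseq Wm W (fun r => prog_value a d v r)))) =
  avg (fun lam : {ffun E -> 'I_Km.+1} => avg (fun phi => avg (fun rho =>
    pavg (enum U) (fun s => model_value s phi (fun x => val (lam x)) rho)))).
Proof.
have e1 a : perm_eq a (enum U) -> avgseq Wm #|U| (fun d => avgseq Km #|U| (fun v =>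
    avgseq Wm W (fun r => prog_value a d v r))) =
  avgseq Wm #|U| (fun d => avg (fun lam : {ffun E -> 'I_Km.+1} => avg (fun rho : {ffun 'I_W -> 'I_W} =>
     prog_value a d [seq val (lam x) | x <- a] [seq val (rho i) | i <- enum 'I_W]))).
  move=> pa; have ua : uniq a by rewrite (perm_uniq pa) enum_uniq.
  apply: eq_avgseq => d _ _; rewrite cardE -(perm_size pa) avgseq_ffun //; apply: eq_avg => lam.
  have := avgseq_ffun Wm (prog_value a d [seq val (lam x) | x <- a]) (enum_uniq 'I_W).
  by rewrite size_enum_ord.
rewrite (eq_pavg e1) pavg_avgseq.
(* Rearranging positions takes a default item, so an empty [U] is treated apart. *)
case: (set_0Vmem U) => [U0|[x0 x0U]].
  rewrite U0 cards0 /= !enum_set0 pavg_avg; apply: eq_avg => lam.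
  rewrite (eq_avg (G := fun=> avg (fun rho : {ffun 'I_W -> 'I_W} => pavg [::] (fun s =>
     model_value s [ffun=> ord0] (fun x => val (lam x)) rho)))); last first.
    move=> phi; apply: eq_avg => rho; apply: eq_pavg => s /perm_nilP ->.
    by rewrite -!prog_value_model /= /blocks.
  rewrite avg_const ?card_ffun ?card_ord ?expn_gt0 // pavg_avg; apply: eq_avg => rho.
  apply: eq_pavg => s /perm_nilP ->; rewrite -prog_value_model /=.
  by rewrite (_ : flatten _ = [::]) // /blocks; elim: (iota 1 Wm).
(* For fixed draws, [p d] lists the positions sorted by draw; a uniform order read along it is again
   uniform. *)
pose p d := flatten (blocks (nth 0%N d) W (iota 0 #|U|)).
rewrite (eq_avgseq (Y := fun d => pavg (enum U) (fun s =>
   let a := [seq nth x0 s i | i <- p d] in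
   avg (fun lam : {ffun E -> 'I_Km.+1} => avg (fun rho : {ffun 'I_W -> 'I_W} =>
     prog_value a d [seq val (lam x) | x <- a] [seq val (rho i) | i <- enum 'I_W]))))); last first.
  move=> d sd ad; apply: pavg_rearrange; first exact: enum_uniq.
  rewrite -cardE; apply: perm_blocks; apply/allP => i; rewrite mem_iota add0n => /andP[_ iU].
  by rewrite ltnS (allP ad) // mem_nth // sd.
rewrite -pavg_avgseq.
rewrite (eq_pavg (G := fun s => avg (fun lam : {ffun E -> 'I_Km.+1} => avg (fun phi => avg (fun rho =>
   model_value s phi (fun x => val (lam x)) rho))))).
  by rewrite pavg_avg; apply: eq_avg => lam; rewrite pavg_avg; apply: eq_avg => phi; rewrite pavg_avg.
move=> s ps; have us : uniq s by rewrite (perm_uniq ps) enum_uniq.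
rewrite cardE -(perm_size ps) avgseq_ffun // avg_exchange; apply: eq_avg => lam.
apply: eq_avg => phi; apply: eq_avg => rho.
rewrite -prog_value_model.
suff -> : [seq nth x0 s i | i <- p [seq val (phi x) | x <- s]] = flatten (blocks (fun x => val (phi x)) W s) by [].
have -> : blocks (fun x => val (phi x)) W s =
    blocks (fun x => val (phi x)) W [seq nth x0 s i | i <- iota 0 (size s)].
  by rewrite -/(mkseq _ _) mkseq_nth.
rewrite blocks_map -map_flatten /p cardE -(perm_size ps).
congr (map _ (flatten _)); apply: eq_map => w; apply: eq_in_filter => i; rewrite mem_iota add0n => /andP[_ ilt] /=.
by rewrite (nth_map x0).
Qed.

End Rearrange.

(** * Competitive ratio of the idealized algorithm *)

Section Total.
Variables (R : realType) (E : finType) (M : matroid E) (f : {set E} -> R).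
Hypotheses (f0 : nonnegative f) (fM : monotone f) (fS : submodular f).

Lemma best_value_ge (A S : {set E}) : S \subset A -> M S -> f S <= best_value M f A.
Proof. by move=> sSA iS; apply: (@le_bigmax_cond _ _ _ _ S _ f); rewrite sSA. Qed.

Lemma best_value_attained (A : {set E}) : exists S : {set E}, [/\ S \subset A, M S & best_value M f A <= f S].
Proof.
have P0 : (set0 \subset A) && M set0 by rewrite sub0set indep0.
case: (@arg_maxP _ R {set E} set0 (fun S => (S \subset A) && M S) f P0) => S /andP[sS iS] h.
by exists S; split=> //; apply/bigmax_leP; split=> [|S' /h].
Qed.

Lemma best_value_ge0 (A : {set E}) : 0 <= best_value M f A.
Proof. exact: le_trans (f0 _) (best_value_ge (sub0set A) (indep0 M)). Qed.

Lemma model_value_ge0 kk K B L Wm s phi lam rho :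
  0 <= model_value M f kk K B L (Wm := Wm) s phi lam rho.
Proof. exact: f0. Qed.

(** From [(1 - t)^2 >= 1 - 2 t] and [expR (4 t) <= 1 / (1 - 4 t) <= 1 + 8 t], the last step by
    [t <= 1 / 8]. *)
Lemma expR_rate (t : R) : 0 <= t -> t <= 8^-1 ->
  expR (- (2 * (1 - t) ^+ 2)) <= (expR 2)^-1 + 8 * t.
Proof.
move=> t0 t1.
have h1 : expR (- (2 * (1 - t) ^+ 2)) <= expR (- 2) * expR (4 * t).
  by rewrite -expRD ler_expR expr2; nra.
have e4 : (1 - 4 * t) * expR (4 * t) <= 1.
  rewrite -[X in _ <= X](expRxMexpNx_1 (4 * t)) mulrC ler_wpM2l ?expR_ge0 //.
  exact: expR_ge1Dx.
have h2 : expR (4 * t) <= 1 + 8 * t.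
  have p0 : 0 < expR (4 * t) by exact: expR_gt0.
  nra.
have e2 : 0 <= expR (- 2 : R) <= 1.
  rewrite expR_ge0 /= -[leRHS]expR0 ler_expR; lra.
rewrite -expRN; move: e2 h1 h2; move: (expR (- 2)) (expR (4 * t)) => a b; nra.
Qed.

(** The 10 splits into 8 for the rate, 1 for colliding keys and 1 for missed items. *)
Lemma total_value (q kk Wm Km : nat) (U : {set E}) (Q := (2 ^ q)%N) :
  (8 <= Q)%N -> (0 < kk)%N -> Wm.+1 = (Q * kk)%N -> (Q * #|U| ^ 2 <= Km.+1)%N ->
  (forall A : {set E}, A \subset U -> M A -> (#|A| <= kk)%N) ->
  2^-1 * (1 - (expR 2)^-1 - 10 / Q%:R) * OPT M f U <=
  pavg (enum U) (fun a => avgseq Wm #|U| (fun d => avgseq Km #|U| (fun v =>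
    avgseq Wm Wm.+1 (fun r => prog_value M f kk Km.+1 (2 * Q) (2 * q.+1) Wm a d v r)))).
Proof.
move=> Q8 kk0 eW hK Ukk.
have [O [OU iO hO]] := best_value_attained U.
pose t : R := Q%:R^-1.
have Q0 : 0 < Q%:R :> R by rewrite ltr0n; lia.
have t0 : 0 < t by rewrite invr_gt0.
have t8 : t <= 8^-1 by rewrite lef_pV2 ?posrE // ler_nat.
have tQ : t * Q%:R = 1 by rewrite mulVf // gt_eqF.
have kkW : (kk <= Wm.+1)%N by rewrite eW leq_pmull //; lia.
have kt : kk%:R * Wm.+1%:R^-1 = t :> R.
  by rewrite eW natrM invfM mulrCA divff ?mulr1 // pnatr_eq0 -lt0n.
(* Here [L = 2 (q + 1)], so [2 ^ (L + 1) = 8 Q^2] and [d] is [1 / (2 Q) + 1 / (4 Q)]. *)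
pose d : R := (2 * Q)%N%:R^-1 + (2 * Q)%N%:R / 2 ^+ (2 * q.+1).+1.
have dt : d <= t.
  have eQ : (2 * Q)%N%:R = 2 * Q%:R :> R by rewrite natrM.
  have e2 : 2 ^+ (2 * q.+1).+1 = 8 * (Q%:R * Q%:R) :> R.
    rewrite -natrX /Q -!natrM; congr (_%:R).
    by rewrite (_ : (2 * q.+1).+1 = 3 + (q + q))%N ?expnD //; lia.
  rewrite /d e2 eQ !invfM -/t.
  have : Q%:R * (t * t) = t by rewrite mulrA [Q%:R * t]mulrC tQ mul1r.
  move=> e; have -> : 2 * Q%:R * (8^-1 * (t * t)) = 2 / 8 * (Q%:R * (t * t)) by ring.
  rewrite e; lra.
rewrite -/t; clearbody t; pose y : R := 1 - expR (- (2 * (1 - t) ^+ 2)).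
have y1 : y <= 1 by rewrite /y gerBl expR_ge0.
have y0 : 0 <= y by rewrite subr_ge0 -[leRHS]expR0 ler_expR oppr_le0 mulr_ge0 ?exprn_even_ge0.
have hy : 1 - (expR 2)^-1 - 8 * t <= y by have := expR_rate (ltW t0) t8; rewrite /y; lra.
have fO := f0 O.
have t1 : 0 <= 1 - t by lra.
have half0 : 0 <= 2^-1 :> R by rewrite invr_ge0.
rewrite avg_prog_value.
apply: (@le_trans _ _ (avg (fun lam : {ffun E -> 'I_Km.+1} =>
   (1 - t) * (2^-1 * y * f O) *
     [forall x in U, forall z in U, (lam x == lam z) ==> (x == z)]%:R))).
  rewrite avgZ.
  have hc := collision_probability R U Km.
  have hn : (#|U| ^ 2)%:R / Km.+1%:R <= t.
    rewrite ler_pdivrMr ?ltr0n // -(ler_pM2l Q0) mulrA [Q%:R * t]mulrC tQ mul1r -natrM ler_nat.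
    exact: hK.
  have z0 : 0 <= 2^-1 * y * f O by rewrite !mulr_ge0.
  apply: (@le_trans _ _ ((1 - t) * (2^-1 * y * f O) * (1 - t))); last first.
    by rewrite ler_wpM2l ?mulr_ge0 // (le_trans _ hc) // lerD2l lerN2.
  apply: (@le_trans _ _ (2^-1 * (y - 2 * t) * OPT M f U)).
    by rewrite ler_wpM2r ?best_value_ge0 // ler_wpM2l //; lra.
  (* [OPT] may be replaced by [f O], which is at least as large, only under a nonnegative factor;
     under a negative one the bound is trivial. *)
  have [yt|yt] := lerP 0 (y - 2 * t); last first.
    apply: (@le_trans _ _ 0); last by rewrite !mulr_ge0 //; lra.
    by rewrite mulr_le0_ge0 ?best_value_ge0 //; lra.
  apply: (@le_trans _ _ (2^-1 * (y - 2 * t) * f O)); first by rewrite ler_wpM2l // mulr_ge0.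
  have -> : (1 - t) * (2^-1 * y * f O) * (1 - t) = 2^-1 * ((1 - t) * (1 - t) * y) * f O by ring.
  rewrite ler_wpM2r // ler_wpM2l //.
  have : 0 <= t * (1 - y) by rewrite mulr_ge0 ?subr_ge0 // ltW.
  have : 0 <= t * t * y by rewrite !mulr_ge0 // ltW.
  nra.
(* Where keys collide, the value is merely bounded below by 0. *)
apply: avg_le => lam; case: (boolP [forall x in U, _]) => [inj|_]; last first.
  rewrite mulr0; apply: avg_ge0 => phi; apply: avg_ge0 => rho.
  rewrite -[leLHS](pavg_const (enum U)); apply: pavg_le => s _; exact: model_value_ge0.
rewrite mulr1.
pose l x := val (lam x).
have lok x : (l x < Km.+1)%N by exact: ltn_ord.
have linj : {in U &, injective l}.
  move=> x z xU zU /val_inj /eqP lxz.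
  by move/forall_inP: inj => /(_ _ xU) /forall_inP /(_ _ zU); rewrite lxz => /eqP.
have B0 : (0 < 2 * Q)%N by rewrite muln_gt0 (leq_trans _ Q8).
apply: (@le_trans _ _ ((1 - d) * mean M f kk Km.+1 Wm (enum U) l Wm.+1)).
  have hm : 2^-1 * y * f O <= mean M f kk Km.+1 Wm (enum U) l Wm.+1.
    have := mean_final f0 fM fS kk0 kkW (mem_enum U) lok Ukk OU iO; rewrite kt => h.
    apply: h; rewrite ler_pdivrMr ?ltr0n // mul1r ler_nat eW.
    by apply: leq_trans (leq_pmulr Q kk0); exact: leq_trans Q8.
  apply: (@le_trans _ _ ((1 - d) * (2^-1 * y * f O))); last by rewrite ler_wpM2l //; lra.
  by rewrite ler_wpM2r ?mulr_ge0 //; lra.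
rewrite /mean avg_exchange -avgZ; apply: avg_le => rho; rewrite -avgZ; apply: avg_le => phi.
exact: (shortset_value M (2 * q.+1) f0 fM fS kk0 B0 (recheck rho) phi Wm.+1 lok linj).
Qed.

End Total.

(** * The program *)

Definition reg (a : nat) : nexp := NLoad (NConst a).
Definition ltn_exp (e1 e2 : nexp) : bexp := BLeN (NAdd e1 (NConst 1)) e2.
Definition incr (a : nat) : instr := SetN (NConst a) (NAdd (reg a) (NConst 1)).
(** Machine integers cannot be multiplied; a product with a literal is unfolded into a sum whose
    size does not depend on the instance. *)
Fixpoint mul_exp (c : nat) (e : nexp) : nexp :=
  if c is c'.+1 then NAdd e (mul_exp c' e) else NConst 0.
Arguments mul_exp : simpl never.

Lemma neval_mul m c e : neval m (mul_exp c e) = (c * neval m e)%N.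
Proof. by elim: c => // c IH; rewrite mulSn -IH. Qed.

(* Integer registers: 0 n, 1 k, 2 W, 3 K, 4 loop index, 5 window, 6 arrival index,
   7 window size, 8 B (i + 1), 9 index i in the window, 10 item, 11 its key, 12 cell,
   13 saved cell, 14 oracle answer, 15 best cell for the item, 16-18 key, item and
   cell of the best offer, 19 record flag, 20 number of items kept in the window.
   Real registers: 0 value of the item, 1 value of the best offer, 2 oracle answer. *)
Definition cell (c : nexp) : nexp := NAdd (NConst 30) c.
(** Five arrays follow one another from address 30: [kk] cells, [W] selections, [n] window draws,
    [n] tie-breaking keys and [W] recheck indices. *)
Definition selected (w : nexp) : nexp := NAdd (NAdd (NConst 30) (reg 1)) w.
Definition draw (j : nexp) : nexp := NAdd (NAdd (NAdd (NConst 30) (reg 1)) (reg 2)) j.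
Definition tiekey (j : nexp) : nexp :=
  NAdd (NAdd (NAdd (NAdd (NConst 30) (reg 1)) (reg 2)) (reg 0)) j.
Definition slot (w : nexp) : nexp :=
  NAdd (NAdd (NAdd (NAdd (NAdd (NConst 30) (reg 1)) (reg 2)) (reg 0)) (reg 0)) w.

(** The oracles read consecutive cells, so a swap is tested in place and then undone. *)
Definition try_cell : program :=
  [:: SetN (NConst 13) (NLoad (cell (reg 12)));
      SetN (cell (reg 12)) (reg 10);
      Indep (NConst 14) (NConst 30) (reg 1);
      Value (NConst 2) (NConst 30) (reg 1);
      If (BAnd (BLeN (NConst 1) (reg 14)) (BNot (BLeR (RLoad (NConst 2)) (RLoad (NConst 0)))))
        [:: SetR (NConst 0) (RLoad (NConst 2)); SetN (NConst 15) (reg 12)] [::];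
      SetN (cell (reg 12)) (reg 13);
      incr 12].

Definition try_cells : instr := While (ltn_exp (reg 12) (reg 1)) try_cell.

Definition compare : instr :=
  If (BAnd (BLeR (RLoad (NConst 0)) (RLoad (NConst 1)))
        (BNot (BAnd (BLeR (RLoad (NConst 1)) (RLoad (NConst 0))) (ltn_exp (reg 16) (reg 11)))))
    [:: SetN (NConst 19) (NConst 0)]
    [:: SetN (NConst 19) (NConst 1); SetR (NConst 1) (RLoad (NConst 0));
        SetN (NConst 16) (reg 11); SetN (NConst 17) (reg 10); SetN (NConst 18) (reg 15)].

Definition consider : program :=
  [:: Value (NConst 0) (NConst 30) (reg 1);
      SetN (NConst 15) (NConst 0); SetN (NConst 12) (NConst 0); try_cells; compare].

Definition process_item (B L : nat) : program :=
  [:: Receive; SetN (NConst 10) (reg 6); SetN (NConst 11) (NLoad (tiekey (reg 6)))] ++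
  consider ++
  [:: If (BAnd (BLeN (NConst 1) (reg 19))
            (BAnd (ltn_exp (reg 7) (reg 8)) (ltn_exp (reg 20) (NConst L))))
        [:: Accept; incr 20] [::];
      incr 6; incr 9; SetN (NConst 8) (NAdd (reg 8) (NConst B))].

Definition process_items B L : instr := While (ltn_exp (reg 9) (reg 7)) (process_item B L).

Definition count_step : program :=
  [:: If (BAnd (BLeN (NLoad (draw (reg 4))) (reg 5)) (BLeN (reg 5) (NLoad (draw (reg 4)))))
        [:: incr 7] [::];
      incr 4].

(** Scanning all draws again in each window costs [O(n W)] steps, which is [O(n k)] for constant
    [Q]. *)
Definition count_draws : instr := While (ltn_exp (reg 4) (reg 0)) count_step.

Definition process_window (B L : nat) : program :=
  [:: SetN (NConst 7) (NConst 0); SetN (NConst 4) (NConst 0); count_draws;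
      Value (NConst 1) (NConst 30) (reg 1); SetN (NConst 16) (reg 3);
      SetN (NConst 17) (NLoad (NConst 30)); SetN (NConst 18) (NConst 0);
      SetN (NConst 20) (NConst 0); SetN (NConst 9) (NConst 0); SetN (NConst 8) (NConst B);
      process_items B L;
      SetN (NConst 10) (NLoad (selected (NLoad (slot (reg 5))))); SetN (NConst 11) (NConst 0)] ++
  consider ++
  [:: SetN (cell (reg 18)) (reg 17); SetN (selected (reg 5)) (reg 17); incr 5].

Definition process_windows B L : instr := While (ltn_exp (reg 5) (reg 2)) (process_window B L).

Definition fill (address : nexp -> nexp) (bound len : nexp) : program :=
  [:: SetN (NConst 4) (NConst 0);
      While (ltn_exp (reg 4) len)
        [:: Rand (address (reg 4)) (NSub bound (NConst 1)); incr 4]].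

(** The number [n] is the index of no item, so it marks empty cells and missing selections. Register
    3 obtains [n^2] by repeated addition. *)
Definition secretary (Q B L : nat) : program :=
  [:: If (BLeN (reg 0) (reg 1)) [:: SetN (NConst 1) (reg 0)] [::];
      If (BLeN (NConst 1) (reg 1))
        ([:: SetN (NConst 2) (mul_exp Q (reg 1));
             SetN (NConst 4) (NConst 0);
             While (ltn_exp (reg 4) (reg 0)) [:: SetN (NConst 3) (NAdd (reg 3) (reg 0)); incr 4];
             SetN (NConst 3) (mul_exp Q (reg 3));
             SetN (NConst 4) (NConst 0);
             While (ltn_exp (reg 4) (NAdd (reg 1) (reg 2)))
               [:: SetN (cell (reg 4)) (reg 0); incr 4]] ++
         fill draw (reg 2) (reg 0) ++ fill tiekey (reg 3) (reg 0) ++ fill slot (reg 2) (reg 2) ++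
         [:: SetN (NConst 5) (NConst 0); SetN (NConst 6) (NConst 0); process_windows B L])
        [::]].

(** * Reasoning about time and expectation of runs *)

Section Execution.
Variables (R : realType) (E : finType) (M : matroid E) (f : {set E} -> R).
Variables (P : config R E -> bool) (g : config R E -> R).

(** Quantifying over all larger [T] allows step counts to be rounded up. A lower bound on the
    expectation suffices, since the shortlist may contain a better set than the tracked one. *)
Definition lower (B : nat) (c : config R E) (x : R) : Prop :=
  forall T, (B <= T)%N -> always M f T P c /\ x <= expected M f T g c.

Lemma lower_leq B B' c x : (B <= B')%N -> lower B c x -> lower B' c x.
Proof. by move=> BB h T BT; apply: h; exact: leq_trans BT. Qed.

Lemma lower_halt B c x : code c = [::] -> P c -> x <= g c -> lower B c x.
Proof. by move=> hc Pc xg [|T] _ /=; rewrite /halted hc. Qed.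

Lemma lower_next B c c' x : step M f c = [:: c'] -> lower B c' x -> lower B.+1 c x.
Proof.
move=> hs h [//|T] BT; have [h1 h2] := h T BT.
have nh : halted c = false by case: c hs {h} => [[]].
by rewrite /= nh hs /= h1 big_seq1 invr1 mul1r.
Qed.

Lemma lower_rand B a e K m r arr pend A (x : nat -> R) :
  (forall j, (j <= neval m e)%N ->
     lower B (Config K (upd m (neval m a) j) r arr pend A) (x j)) ->
  lower B.+1 (Config (Rand a e :: K) m r arr pend A)
    ((neval m e).+1%:R^-1 * \sum_(j <- iota 0 (neval m e).+1) x j).
Proof.
move=> h [//|T] BT.
set s := [seq Config K (upd m (neval m a) j) r arr pend A | j <- iota 0 (neval m e).+1].
split; first change (all (always M f T P) s).
  rewrite all_map; apply/allP => j; rewrite mem_iota add0n ltnS => je.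
  by have [] := h j je T BT.
change ((neval m e).+1%:R^-1 * \sum_(j <- iota 0 (neval m e).+1) x j <=
  (size s)%:R^-1 * \sum_(c <- s) expected M f T g c).
rewrite size_map size_iota big_map ler_wpM2l ?invr_ge0 ?ler0n //.
rewrite big_seq [leRHS]big_seq; apply: ler_sum => j; rewrite mem_iota add0n ltnS => je.
by have [] := h j je T BT.
Qed.

(** [None] must be denoted by an index of at least [n]: a smaller one would start to denote an item
    after later arrivals. *)
Definition denotes n (arr : seq E) i (o : option E) : bool :=
  (onth arr i == o) && ((i < size arr)%N || (n <= i)%N).

Definition cells_ok n arr (m : nat -> nat) kk (S : seq (option E)) : Prop :=
  size S = kk /\ forall c, (c < kk)%N -> denotes n arr (m (30 + c)%N) (nth None S c).

Lemma query_cells n arr m kk S : cells_ok n arr m kk S ->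
  query_set arr m 30 kk = items S.
Proof.
move=> [sS h]; rewrite /query_set /items.
have -> : S = [seq onth arr (m j) | j <- iota 30 kk].
  apply: (@eq_from_nth _ None); first by rewrite size_map size_iota.
  move=> c; rewrite sS => cS; rewrite (nth_map 0%N) ?size_iota // nth_iota //.
  by have /andP[/eqP-> _] := h c cS.
suff <- : pmap (fun j => onth arr (m j)) (iota 30 kk) =
  pmap id [seq onth arr (m j) | j <- iota 30 kk] by [].
by elim: (iota 30 kk) => //= j l ->; case: (onth _ _).
Qed.

Lemma cells_put n arr m kk S c i e : cells_ok n arr m kk S -> (c < kk)%N -> denotes n arr i e ->
  cells_ok n arr (upd m (30 + c)%N i) kk (put S c e).
Proof.
move=> [sS h] ck ie; split; first by rewrite size_put ?sS.
move=> c' ck'; rewrite /put nth_set_nth /= /upd eqn_add2l; case: eqP => // _; exact: h.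
Qed.

Lemma eq_cells n arr m m' kk S : cells_ok n arr m kk S ->
  (forall c, (c < kk)%N -> m' (30 + c)%N = m (30 + c)%N) -> cells_ok n arr m' kk S.
Proof. by move=> [sS h] e; split=> // c ck; rewrite e //; exact: h. Qed.

End Execution.

Lemma upd_eq T (m : nat -> T) a v : upd m a v a = v.
Proof. by rewrite /upd eqxx. Qed.

Lemma upd_neq T (m : nat -> T) a b v : b <> a -> upd m a v b = m b.
Proof. by move=> /eqP ba; rewrite /upd (negPf ba). Qed.

Ltac mem := repeat first [rewrite upd_eq | rewrite upd_neq; [|by [] || lia]].
Ltac next := eapply lower_next; [reflexivity|rewrite /=].

(** * Correctness of the program *)

Section Consider.
Local Open Scope nat_scope.
Variables (R : realType) (E : finType) (M : matroid E) (f : {set E} -> R).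
Variables (P : config R E -> bool) (g : config R E -> R).
Variables (n kk : nat).
Local Notation low := (lower M f P g).

Lemma lower_try_cells B C K (m : nat -> nat) (r : nat -> R) arr pend A x S e c p :
  (c + C = kk) -> m 1 = kk -> m 12 = c -> cells_ok n arr m kk S -> denotes n arr (m 10) e ->
  (r 0, m 15) = p ->
  (forall m' r', (forall a, (a < 12) || (15 < a) -> m' a = m a) -> r' 1 = r 1 ->
     (r' 0, m' 15) = foldl (swap_step M f S e) p (iota c C) ->
     low B (Config K m' r' arr pend A) x) ->
  low (B + 10 * C).+1 (Config (try_cells :: K) m r arr pend A) x.
Proof.
elim: C c m r p => [|C IH] c m r p hc m1 m12 cm re hp h.
  next; rewrite m12 m1 (_ : (c + 1 <= kk) = false) /=; last by lia.
  by rewrite muln0 addn0; apply: h.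
next; rewrite m12 m1 (_ : (c + 1 <= kk)); last by lia.
have ck : (c < kk) by lia.
pose m1' := upd (upd m 13 (m (30 + c))) (30 + c) (m 10).
have cm1 : cells_ok n arr m1' kk (put S c e).
  by apply: cells_put => //; apply: (eq_cells cm) => c' _; mem.
have m1'1 : m1' 1 = kk by rewrite /m1'; mem.
set A' := items (put S c e).
apply: (@lower_leq _ _ _ _ _ _ ((B + 10 * C).+4.+4.+2)); first by lia.
next; next; mem; rewrite m12 -/m1'.
next; rewrite m1'1 (query_cells cm1) -/A'.
next; mem; rewrite m1'1 (@query_cells _ n _ _ _ (put S c e)); last first.
  by apply: (eq_cells cm1) => c' _; mem.
rewrite -/A'; next; mem.
pose m2 := upd m1' 14 (M A').
have rest m3 r3 : (forall a, a != 15 -> m3 a = m2 a) -> r3 1 = r 1 ->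
   (r3 0, m3 15) = swap_step M f S e p c ->
   low (B + 10 * C).+3 (Config [:: SetN (cell (reg 12)) (reg 13), incr 12, try_cells & K] m3 r3 arr pend A) x.
  move=> hm3 hr3 hp3; next; next; mem.
  have e13 : m3 13 = m (30 + c) by rewrite hm3 // /m2 /m1'; mem.
  have e12 : m3 12 = c by rewrite hm3 // /m2 /m1'; mem.
  rewrite e12 e13; apply: (IH c.+1 _ _ (swap_step M f S e p c)).
  - by lia.
  - by mem; rewrite hm3 // /m2 /m1'; mem.
  - by mem; rewrite addn1.
  - apply: (eq_cells cm) => c' ck'; mem; rewrite /upd eqn_add2l; case: eqP => [->//|cc'].
    rewrite hm3 /m2; last by lia.
    by mem; rewrite /m1' upd_neq; [mem|lia].
  - by mem; rewrite hm3 // /m2 /m1'; mem.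
  - by mem; exact: hp3.
  move=> m' r' hm' hr' hp'; apply: h => //; last by rewrite hr'.
  move=> a ha; rewrite hm' //.
  have [->|/eqP ac] := eqVneq a (30 + c); first by mem.
  by mem; rewrite hm3 /m2 /m1'; [mem|lia].
case: ifP => hA /=; last first.
  apply: (@lower_leq _ _ _ _ _ _ (B + 10 * C).+3); first by lia.
  apply: rest; [by []|by mem|].
  mem; rewrite /m1'; mem; rewrite hp /swap_step -/A' -hp /= ltNge.
  by move: hA; case: (M A') => //= ->.
next; next; mem; apply: rest.
- by move=> a /eqP ha; mem.
- by mem.
mem; rewrite /m1'; mem; rewrite m12 /swap_step -/A' -hp /= ltNge.
by move: hA; case: (M A') => //= ->.
Qed.

Lemma lower_consider B K (m : nat -> nat) (r : nat -> R) arr pend A x S e key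
    (b : (R * nat) * (option E * nat)) :
  m 1 = kk -> m 11 = key -> cells_ok n arr m kk S -> denotes n arr (m 10) e ->
  r 1 = b.1.1 -> m 16 = b.1.2 -> denotes n arr (m 17) b.2.1 -> m 18 = b.2.2 ->
  (forall m' r', (forall a, (a < 12) || (19 < a) -> m' a = m a) ->
     let o := offer M f kk S e key in let b' := challenge fst b o in
     r' 1 = b'.1.1 -> m' 16 = b'.1.2 -> denotes n arr (m' 17) b'.2.1 -> m' 18 = b'.2.2 ->
     m' 19 = ~~ lexle o.1 b.1 ->
     low B (Config K m' r' arr pend A) x) ->
  low (B + 10 * kk + 10) (Config (consider ++ K) m r arr pend A) x.
Proof.
move=> m1 m11 cm de r1 m16 d17 m18 h; rewrite /consider.
apply: (@lower_leq _ _ _ _ _ _ ((B.+4.+2 + 10 * kk).+4)); first by lia.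
next; next; next; rewrite m1 (query_cells cm).
apply: (@lower_try_cells _ kk _ _ _ _ _ _ _ S e 0 (f (items S), 0)).
- by [].
- by mem.
- by mem.
- by apply: (eq_cells cm) => c ck; mem.
- by mem.
- by mem.
move=> m' r' hm' hr' hp'; rewrite -/(swap_value M f kk S e) in hp'.
rewrite /compare; next.
have e16 : m' 16 = b.1.2 by rewrite hm' //; mem.
have e11 : m' 11 = key by rewrite hm' //; mem.
have e10 : m' 10 = m 10 by rewrite hm' //; mem.
rewrite hr' upd_neq // r1 e16 e11.
have eo : offer M f kk S e key = ((r' 0, key), (e, m' 15)) by rewrite /offer -hp'.
rewrite addn1 -[(_ <= b.1.1)%R && _]/(lexle (r' 0, key) b.1).
case: ifP => hc /=.
  apply: (@lower_leq _ _ _ _ _ _ B.+1); first by lia.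
  have e17 : m' 17 = m 17 by rewrite hm' //; mem.
  have e18 : m' 18 = m 18 by rewrite hm' //; mem.
  next; apply: h; rewrite ?eo /challenge /= ?hc /=.
  - by move=> a ha; mem; rewrite hm'; [mem|lia].
  - by rewrite hr'; mem.
  - by mem.
  - by mem; rewrite e17.
  - by mem; rewrite e18.
  - by mem.
next; next; next; next; next; apply: h; rewrite ?eo /challenge /= ?hc /=.
- by move=> a ha; mem; rewrite hm'; [mem|lia].
- by mem.
- by mem.
- by mem; rewrite e10.
- by mem.
- by mem.
Qed.

End Consider.

Section Windows.
Local Open Scope nat_scope.
Variables (R : realType) (E : finType) (M : matroid E) (f : {set E} -> R).
Variables (P : config R E -> bool) (g : config R E -> R).
Variables (a : seq E) (kk Wm K B L : nat) (d v rv : seq nat).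
Local Notation W := Wm.+1.
Local Notation n := (size a).
Local Notation low := (lower M f P g).
Hypothesis ua : uniq a.
Implicit Types (m : nat -> nat) (r : nat -> R) (S sel : seq (option E)) (arr : seq E).

Definition mem_ok arr m S sel : Prop :=
  [/\ [/\ m 0 = n, m 1 = kk, m 2 = W & m 3 = K], cells_ok n arr m kk S,
      forall w, w < W -> denotes n arr (m (30 + kk + w)) (nth None sel w),
      (forall j, j < n -> m (30 + kk + W + j) = nth 0 d j) /\
      (forall j, j < n -> m (30 + kk + W + n + j) = nth 0 v j) &
      forall w, w < W -> m (30 + kk + W + n + n + w) = nth 0 rv w].

Lemma mem_ok_frame arr m m' S sel : mem_ok arr m S sel ->
  (forall b, (b < 4) || (30 <= b) -> m' b = m b) -> mem_ok arr m' S sel.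
Proof.
case=> [[h0 h1 h2 h3] hc hs [hd hv] hr] e.
split; [by rewrite !e| | |split|].
- by apply: (eq_cells hc) => c _; rewrite e //; lia.
- by move=> w wW; rewrite e; [exact: hs|lia].
- by move=> j jn; rewrite e; [exact: hd|lia].
- by move=> j jn; rewrite e; [exact: hv|lia].
- by move=> w wW; rewrite e; [exact: hr|lia].
Qed.

Lemma denotes_rcons arr x i o : size arr < n -> denotes n arr i o -> denotes n (rcons arr x) i o.
Proof.
move=> sn /andP[/eqP<- hi]; rewrite /denotes size_rcons.
case: (ltnP i (size arr)) hi => [lt _|ge /= ni].
  by rewrite -cats1 onth_cat lt eqxx ltnS ltnW.
by rewrite !onth_default ?size_rcons // ?ni ?orbT //; exact: leq_trans ni.
Qed.

Lemma mem_ok_rcons arr m S sel x : size arr < n -> mem_ok arr m S sel ->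
  mem_ok (rcons arr x) m S sel.
Proof.
move=> sn [h0 [sS hc] hs hd hr]; split=> //; last by move=> w /hs; exact: denotes_rcons.
by split=> // c /hc; exact: denotes_rcons.
Qed.

Definition best_ok arr m r (b : (R * nat) * (option E * nat)) : Prop :=
  [/\ r 1 = b.1.1, m 16 = b.1.2, denotes n arr (m 17) b.2.1 & m 18 = b.2.2].

Local Notation lam := (prog_keys a v).

Lemma lower_accept C K' m r arr y pend A x :
  low C (Config K' m r (rcons arr y) pend (y |: A)) x ->
  low C.+1 (Config (Accept :: K') m r (rcons arr y) pend A) x.
Proof.
by apply: lower_next; case: arr => //= y0 arr; rewrite last_rcons.
Qed.

(** Register 8 carries [B (i + 1)], so the end of the observation phase is tested without a
    division. *)
Lemma lower_process_items C K' m r arr z rest A0 x S sel msz p :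
  arr ++ z ++ rest = a -> mem_ok arr m S sel -> m 6 = size arr -> m 7 = msz ->
  m 9 = p.1.1 -> p.1.1 + size z = msz -> m 8 = B * p.1.1.+1 -> best_ok arr m r p.1.2 ->
  m 20 = size p.2 ->
  let p' := foldl (keep_step fst (fun y => offer M f kk S (Some y) (lam y)) B L msz) p z in
  (forall m' r', mem_ok (arr ++ z) m' S sel -> m' 5 = m 5 -> m' 6 = size (arr ++ z) ->
     best_ok (arr ++ z) m' r' p'.1.2 ->
     low C (Config K' m' r' (arr ++ z) rest (A0 :|: [set y in p'.2])) x) ->
  low (C + (10 * kk + 20) * size z).+1
    (Config (process_items B L :: K') m r arr (z ++ rest) (A0 :|: [set y in p.2])) x.
Proof.
elim: z m r arr p => [|y z IH] m r arr p ha hm m6 m7 m9 hp m8 hb m20 p' h.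
  next; rewrite m9 m7 (_ : (p.1.1 + 1 <= msz) = false); last by move: hp => /=; lia.
  rewrite muln0 addn0 -[arr]cats0; apply: h => //; by rewrite cats0.
next; rewrite m9 m7 (_ : (p.1.1 + 1 <= msz)); last by move: hp => /=; lia.
have sarr : size arr < n by rewrite -ha size_cat /=; lia.
have hm' := mem_ok_rcons y sarr hm.
have [[m0 m1 m2 m3] hc hs [hd hv] hr] := hm'.
have ey : index y a = size arr.
  move: ua; rewrite -ha cat_uniq => /and3P[_ nh _]; rewrite index_cat /= eqxx addn0.
  by case: ifP => // yarr; case/hasP: nh; exists y => //; rewrite inE eqxx.
apply: (@lower_leq _ _ _ _ _ _ (((C + (10 * kk + 20) * size z).+4.+3 + 10 * kk + 10).+3)); first by move=> /=; lia.
next; next; next.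
apply: (@lower_consider _ _ _ _ _ _ n kk _ _ _ _ _ _ _ _ S (Some y) (lam y) p.1.2).
- by mem.
- by mem; rewrite m0 m1 m2 m6 hv // /prog_keys ey.
- by apply: (eq_cells hc) => c ck; mem.
- by mem; rewrite m6 /denotes size_rcons -cats1 onth_cat ltnn subnn /= eqxx ltnS leqnn.
- by case: hb.
- by mem; case: hb.
- by mem; case: hb => _ _ + _; exact: denotes_rcons.
- by mem; case: hb.
move=> m' r' em o b' r1' m16' m17' m18' m19'.
have e20 : m' 20 = size p.2 by rewrite em //; mem.
have e6 : m' 6 = size arr by rewrite em //; mem.
have e7 : m' 7 = msz by rewrite em //; mem.
have e8 : m' 8 = B * p.1.1.+1 by rewrite em //; mem.
have e9 : m' 9 = p.1.1 by rewrite em //; mem.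
have e5 : m' 5 = m 5 by rewrite em //; mem.
pose p1 := keep_step fst (fun y => offer M f kk S (Some y) (lam y)) B L msz p y.
have rest3 m3' : (forall b, b != 20 -> m3' b = m' b) -> m3' 20 = size p1.2 ->
  low (C + (10 * kk + 20) * size z).+4
    (Config [:: incr 6, incr 9, SetN (NConst 8) (NAdd (reg 8) (NConst B)), process_items B L & K']
       m3' r' (rcons arr y) (z ++ rest) (A0 :|: [set y0 in p1.2])) x.
  move=> em3 e20'; do 3 next; mem; rewrite !em3 // e6 e9 e8. apply: (IH _ _ _ p1).
  - by rewrite cat_rcons.
  - apply: (mem_ok_frame hm') => b hb'; mem; rewrite em3; last by lia.
    by rewrite em; [mem|lia].
  - by mem; rewrite size_rcons addn1.
  - by mem; rewrite em3.
  - by mem; rewrite addn1.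
  - by rewrite -hp /=; lia.
  - by mem; rewrite /p1 /=; lia.
  - by split; mem; rewrite ?em3.
  - by mem.
  rewrite cat_rcons => m4 r4 h1 h2 h3 h4; apply: h => //; rewrite h2; mem.
  by rewrite em3.
next; rewrite m19' e7 e8 e20 lt0b !addn1.
have ep1 : p1.2 = if [&& ~~ lexle o.1 p.1.2.1, msz < B * p.1.1.+1 & size p.2 < L]
                  then rcons p.2 y else p.2 by [].
case: ifP ep1 => hcond ep1 /=.
  apply: lower_accept; next; mem; rewrite e20.
  have -> : y |: (A0 :|: [set y0 in p.2]) = A0 :|: [set y0 in p1.2].
    by apply/setP => t; rewrite ep1 !inE mem_rcons inE orbCA.
  apply: rest3; first by move=> b /eqP ?; mem.
  by mem; rewrite ep1 size_rcons addn1.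
apply: (@lower_leq _ _ _ _ _ _ (C + (10 * kk + 20) * size z).+4); first by lia.
have -> : A0 :|: [set y0 in p.2] = A0 :|: [set y0 in p1.2] by rewrite ep1.
by apply: rest3 => //; rewrite e20 ep1.
Qed.

Lemma lower_count_draws C j c K' m r arr pend A x S sel w :
  c + j = n -> mem_ok arr m S sel -> m 4 = c -> m 5 = w -> size d = n ->
  (forall m', (forall b, b != 4 -> b != 7 -> m' b = m b) ->
     m' 7 = m 7 + count_mem w (drop c d) -> low C (Config K' m' r arr pend A) x) ->
  low (C + 4 * j).+1 (Config (count_draws :: K') m r arr pend A) x.
Proof.
elim: j c m => [|j IH] c m hc hm m4 m5 sd h; have [[m0 m1 m2 m3] _ _ [hd _] _] := hm.
  next; rewrite m4 m0 (_ : (c + 1 <= n) = false); last by lia.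
  rewrite muln0 addn0; apply: h => //; by rewrite drop_oversize ?addn0 //; lia.
next; rewrite m4 m0 (_ : (c + 1 <= n)); last by lia.
apply: (@lower_leq _ _ _ _ _ _ (C + 4 * j).+4); first by lia.
next; rewrite m1 m2 m4 hd ?m5; last by lia.
rewrite -eqn_leq.
have ed : drop c d = nth 0 d c :: drop c.+1 d by rewrite (drop_nth 0) // sd; lia.
have rest m3' : (forall b, b != 7 -> m3' b = m b) -> m3' 7 = m 7 + (nth 0 d c == w) ->
  low (C + 4 * j).+2 (Config [:: incr 4, count_draws & K'] m3' r arr pend A) x.
  move=> em e7; next; apply: (IH c.+1) => //.
  - by lia.
  - by apply: (mem_ok_frame hm) => b hb; mem; rewrite em //; lia.
  - by mem; rewrite em // m4 addn1.
  - by mem; rewrite em.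
  move=> m' hm' h7; apply: h => [b b4 b7|].
    by rewrite hm' //; move/eqP: b4 => ?; mem; rewrite em.
  by rewrite h7; mem; rewrite e7 ed /= addnA.
case: ifP => hw /=; last first.
  by apply: (@lower_leq _ _ _ _ _ _ (C + 4 * j).+2); [lia|apply: rest; rewrite ?hw ?addn0].
next; apply: rest; first by move=> b /eqP ?; mem.
by mem; rewrite hw.
Qed.

Hypotheses (fM : monotone f) (kk0 : 0 < kk) (K0 : 0 < K).
Hypotheses (sd : size d = n) (dW : all (fun j => j < W) d).
Hypotheses (vK : all (fun j => j < K) v).
Hypotheses (srv : size rv = W) (rvW : all (fun j => j < W) rv).

Local Notation counts := [seq count_mem w d | w <- iota 0 W].
Local Notation st w := (state M f kk K lam (nth 0 rv) (prog_windows Wm a d) w).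
Local Notation short w := (shortset M f kk K B L lam (nth 0 rv) (prog_windows Wm a d) w).

Lemma sumn_counts : sumn counts = n.
Proof.
rewrite -sd -(perm_size (perm_blocks (g := id) dW)) size_flatten; congr sumn.
by rewrite /shape -map_comp; apply: eq_map => w /=; rewrite size_filter.
Qed.

Lemma keys_bound x : lam x < K.
Proof.
rewrite /prog_keys; have [h|h] := ltnP (index x a) (size v); last by rewrite nth_default.
by apply: (allP vK); exact: mem_nth.
Qed.

Lemma size_prog_windows w : w < W -> size (prog_windows Wm a d w) = count_mem w d.
Proof.
move=> wW; have sh : shape (reshape counts a) = counts by rewrite reshapeKl ?sumn_counts.
have := congr1 (fun s => nth 0 s w) sh; rewrite (nth_map 0) ?size_iota // nth_iota // => <-.
rewrite (nth_map [::]) // -(size_map size) -/(shape _) sh size_map size_iota //.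
Qed.

(** Time is charged per window and, separately, per pending item, because the window sizes vary and
    only their total is fixed. *)
Lemma lower_process_windows C u w K' m r arr pend x :
  w + u = W -> arr ++ pend = a -> pend = flatten (drop w (reshape counts a)) ->
  mem_ok arr m (st w).1 (st w).2 -> m 5 = w -> m 6 = size arr ->
  (forall m' r' arr' pend', low C (Config K' m' r' arr' pend' (short W)) x) ->
  low (C + (4 * n + 10 * kk + 40) * u + (10 * kk + 20) * size pend).+1
    (Config (process_windows B L :: K') m r arr pend (short w)) x.
Proof.
elim: u w m r arr pend => [|u IH] w m r arr pend hw ha hp hm m5 m6 h;
  have [[m0 m1 m2 m3] hc hs [hd hv] hr] := hm.
  next; rewrite m5 m2 (_ : (w + 1 <= W) = false); last by lia.
  apply: (@lower_leq _ _ _ _ _ _ C); first by lia.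
  by have -> : w = W by [lia]; exact: h.
have wW : w < W by lia.
next; rewrite m5 m2 (_ : (w + 1 <= W)); last by lia.
set z := prog_windows Wm a d w.
have sre : size (reshape counts a) = W.
  by rewrite -(size_map size) -/(shape _) reshapeKl ?sumn_counts ?size_map ?size_iota.
have sz : size z = count_mem w d by exact: size_prog_windows.
pose rest := flatten (drop w.+1 (reshape counts a)).
have ep : pend = z ++ rest by rewrite hp (drop_nth [::]) ?sre.
have [sS iS uS sSsel _] := state_ok (U := [set: E]) M fM kk0 (nth 0 rv) keys_bound w
  (zs := prog_windows Wm a d) (fun _ _ _ => in_setT _).
have ssel : size (st w).2 = w by rewrite size_sel.
pose S := (st w).1; pose sel := (st w).2.
apply: (@lower_leq _ _ _ _ _ _ (((((((C + (4 * n + 10 * kk + 40) * u + (10 * kk + 20) * size rest).+1.+3)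
   + 10 * kk + 10).+2 + (10 * kk + 20) * size z).+1.+4.+3) + 4 * n).+1.+2)).
  by rewrite ep size_cat; nia.
next; next.
apply: (@lower_count_draws _ n 0 _ _ _ _ _ _ _ S sel w).
- by [].
- by apply: (mem_ok_frame hm) => b hb; mem.
- by mem.
- by mem.
- exact: sd.
move=> m' em; mem; rewrite drop0 add0n -sz => e7.
have hm' : mem_ok arr m' S sel.
  by apply: (mem_ok_frame hm) => b hb; rewrite em; [mem|lia|lia].
have e1 : m' 1 = kk by case: hm' => -[].
have e3 : m' 3 = K by case: hm' => -[].
have [_ hc' _ _ _] := hm'.
next; rewrite e1 (query_cells hc').
next; next; next; next; next; next.
have -> : short w = short w :|: [set y in ([::] : seq E)].
  by apply/setP => t; rewrite !inE orbF.
rewrite ep; apply: (@lower_process_items _ _ _ _ _ _ rest _ _ S sel (size z) (0, idle f K S, [::])).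
- by rewrite -ep.
- by apply: (mem_ok_frame hm') => b hb; mem.
- by mem; rewrite em //; mem.
- by mem.
- by mem.
- by [].
- by mem; rewrite muln1.
- split=> /=; [by mem|by mem; rewrite e3|mem|by mem].
  by have [_ hc0] := hc'; exact: (hc0 0 kk0).
- by mem.
rewrite -/(keep fst (fun y => offer M f kk S (Some y) (lam y)) (idle f K S) B L (size z) z).
rewrite keep_leader /leader.
move=> m3' r3 hm3 e5 e6 hb; rewrite -/(kept M f kk K B L lam S z).
have {}e5 : m3' 5 = w by rewrite e5; mem; rewrite em //; mem.
have [[f0' f1 f2 f3] fc fs _ fr] := hm3.
have rw : nth 0 rv w < W by apply: (allP rvW); rewrite mem_nth ?srv.
next; next; rewrite f1 f2 f0' e5 fr //.
apply: (@lower_consider _ _ _ _ _ _ n kk _ _ _ _ _ _ _ _ S (nth None sel (nth 0 rv w)) 0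
   (fmax fst (idle f K S) (offers M f kk S lam z))).
- by mem.
- by mem.
- by apply: (eq_cells fc) => c ck; mem.
- by mem; exact: fs.
- by case: hb.
- by mem; case: hb.
- by mem; case: hb.
- by mem; case: hb.
move=> m4 r4 em4 o b'; rewrite /b' /o /challenge -/(challenge fst _ _) -fmax_rcons.
rewrite -/(window_best M f kk K S sel lam z (nth 0 rv w)); set b := window_best _ _ _ _ _ _ _ _ _.
move=> hr1 h16 h17 h18 _.
have [bk _ _ _] := window_best_spec fM kk0 sel z (nth 0 rv w) sS keys_bound iS.
have {}bk : b.2.2 < kk := bk.
have e4 a' : (a' < 10) || (19 < a') -> m4 a' = m3' a' by move=> ha'; rewrite em4; [mem|lia].
do 3 next; mem.
have e41 : m4 1 = kk by rewrite e4.
have e45 : m4 5 = w by rewrite e4.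
rewrite h18 e41 e45.
apply: (IH w.+1) => //.
- by lia.
- by rewrite -catA -ep.
- rewrite /= -/S -/sel -/z -/b; split.
  + by split; mem; rewrite e4.
  + have := cells_put (e := b.2.1) (i := m4 17) (c := b.2.2) (m := m4) (n := n) (arr := arr ++ z) (kk := kk) (S := S).
    move=> hput; apply: (eq_cells (hput _ bk h17)); last by move=> c ck; mem.
    by apply: (eq_cells fc) => c ck; rewrite e4 //; lia.
  + move: (b.2.2) bk => bc bk w' w'W; rewrite nth_rcons ssel; case: (ltngtP w' w) => hw'.
    * by mem; rewrite e4; [exact: fs|lia].
    * mem; rewrite e4; last by lia.
      by have := fs _ w'W; rewrite nth_default // ssel ltnW.
    * by rewrite hw'; mem.
  + have [_ _ _ [gd gv] _] := hm3; move: (b.2.2) bk => bc bk; split=> j jn; mem; rewrite e4; [exact: gd|lia|exact: gv|lia].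
  + by move: (b.2.2) bk => bc bk w' w'W; mem; rewrite e4; [exact: fr|lia].
- by mem; rewrite addn1.
- by mem; rewrite e4.
Qed.

End Windows.

(** * Initialization of the memory *)

Section Initialization.
Local Open Scope nat_scope.
Variables (R : realType) (E : finType) (M : matroid E) (f : {set E} -> R).
Variables (P : config R E -> bool) (g : config R E -> R).
Local Notation low := (lower M f P g).
Implicit Types (m : nat -> nat) (r : nat -> R) (arr pend : seq E).

(** The loop changes only register 4 and a block starting at 30 or later, so the expressions
    [address], [bound] and [len] keep their meaning. *)
Lemma lower_fill_loop address bound len base N e C t c K' m r arr pend A (X : seq nat -> R) :
  30 <= base ->
  (forall m', (forall b, b < 4 -> m' b = m b) ->
     [/\ neval m' (address (reg 4)) = base + m' 4, neval m' len = N & neval m' bound = e.+1]) ->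
  c + t = N -> m 4 = c ->
  (forall w, size w = t -> all (fun j => j < e.+1) w ->
     forall m', (forall b, b != 4 -> (b < base + c) || (base + c + t <= b) -> m' b = m b) ->
     (forall j, j < t -> m' (base + c + j) = nth 0 w j) ->
     low C (Config K' m' r arr pend A) (X w)) ->
  low (C + 3 * t).+1
    (Config (While (ltn_exp (reg 4) len) [:: Rand (address (reg 4)) (NSub bound (NConst 1)); incr 4] :: K')
       m r arr pend A) (avgseq e t X).
Proof.
move=> base30; elim: t c m X => [|t IH] c m X hm hc m4 h; have [ha hl hb] := hm m (fun _ _ => erefl).
  next; rewrite m4 hl (_ : (c + 1 <= N) = false); last by lia.
  by rewrite muln0 addn0; apply: h.
next; rewrite m4 hl (_ : (c + 1 <= N)); last by lia.
apply: (@lower_leq _ _ _ _ _ _ (C + 3 * t).+3); first by lia.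
have he : neval m (NSub bound (NConst 1)) = e by rewrite /= hb subn1.
have := @lower_rand _ _ M f P g (C + 3 * t).+2 (address (reg 4)) (NSub bound (NConst 1))
  [:: incr 4, While (ltn_exp (reg 4) len) [:: Rand (address (reg 4)) (NSub bound (NConst 1)); incr 4] & K']
  m r arr pend A (fun j => avgseq e t (fun w => X (j :: w))).
rewrite he ha m4; apply=> j je; next; mem; rewrite m4.
apply: (IH c.+1).
- by move=> m' hm'; apply: hm => b b4; rewrite hm' //; mem.
- by lia.
- by mem; rewrite addn1.
move=> w sw aw m' hm1 hm2; apply: (h (j :: w)) => /=; rewrite ?sw //; first by rewrite aw ltnS je.
  by move=> b b4 hb'; rewrite hm1 //; [move/eqP: b4 => ?; mem|lia].
case=> [_|i it] /=.
  by rewrite addn0 hm1; [mem|lia|lia].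
by rewrite -hm2 //; congr (m' _); lia.
Qed.

Lemma lower_fill_cells C t c K' m r arr pend A x :
  c + t = m 1 + m 2 -> m 4 = c ->
  (forall m', (forall b, b != 4 -> (b < 30 + c) || (30 + c + t <= b) -> m' b = m b) ->
     (forall j, j < t -> m' (30 + c + j) = m 0) ->
     low C (Config K' m' r arr pend A) x) ->
  low (C + 3 * t).+1
    (Config (While (ltn_exp (reg 4) (NAdd (reg 1) (reg 2))) [:: SetN (cell (reg 4)) (reg 0); incr 4] :: K')
       m r arr pend A) x.
Proof.
elim: t c m => [|t IH] c m hc m4 h.
  next; rewrite m4 (_ : (c + 1 <= m 1 + m 2) = false); last by lia.
  by rewrite muln0 addn0; apply: h.
next; rewrite m4 (_ : (c + 1 <= m 1 + m 2)); last by lia.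
apply: (@lower_leq _ _ _ _ _ _ (C + 3 * t).+3); first by lia.
do 2 next; mem; rewrite m4; apply: (IH c.+1).
- by mem; lia.
- by mem; rewrite addn1.
move=> m' hm1 hm2; apply: h.
  by move=> b b4 hb'; rewrite hm1 //; [move/eqP: b4 => ?; mem|lia].
case=> [_|i it] /=.
  by rewrite addn0 hm1; [mem|lia|lia].
by have := hm2 i it; mem => <-; congr (m' _); lia.
Qed.

Lemma lower_square C t c K' m r arr pend A x :
  c + t = m 0 -> m 4 = c ->
  (forall m', (forall b, b != 4 -> b != 3 -> m' b = m b) -> m' 3 = m 3 + t * m 0 ->
     low C (Config K' m' r arr pend A) x) ->
  low (C + 3 * t).+1
    (Config (While (ltn_exp (reg 4) (reg 0)) [:: SetN (NConst 3) (NAdd (reg 3) (reg 0)); incr 4] :: K')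
       m r arr pend A) x.
Proof.
elim: t c m => [|t IH] c m hc m4 h.
  next; rewrite m4 (_ : (c + 1 <= m 0) = false); last by lia.
  by rewrite muln0 addn0; apply: h => //; rewrite mul0n addn0.
next; rewrite m4 (_ : (c + 1 <= m 0)); last by lia.
apply: (@lower_leq _ _ _ _ _ _ (C + 3 * t).+3); first by lia.
do 2 next; mem; rewrite m4; apply: (IH c.+1).
- by mem; lia.
- by mem; rewrite addn1.
move=> m' hm1; mem => hm2; apply: h.
  by move=> b /eqP b4 /eqP b3; rewrite hm1; [mem|lia|lia].
by rewrite hm2; lia.
Qed.

End Initialization.

Section Secretary.
Local Open Scope nat_scope.
Variables (R : realType) (E : finType) (M : matroid E) (f : {set E} -> R).
Hypothesis fM : monotone f.
Variables (P : config R E -> bool) (g : config R E -> R).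
Variables (a : seq E) (Q B L Wm Km : nat).
Local Notation n := (size a).
Local Notation kk := (minn n (rank M)).
Local Notation low := (lower M f P g).
Hypotheses (ua : uniq a) (kk0 : 0 < kk) (eW : Wm.+1 = Q * kk) (eK : Km.+1 = Q * (n * n)).
Hypothesis hP : forall c, #|shortlist c| <= Wm.+1 * L -> P c.
Hypothesis hg : forall c, (best_value M f (shortlist c) <= g c)%R.

Lemma lower_secretary :
  low (200 * Q * (n * kk)) (start R M (secretary Q B L) a)
    (avgseq Wm n (fun d => avgseq Km n (fun v => avgseq Wm Wm.+1 (fun rv =>
       prog_value M f kk Km.+1 B L Wm a d v rv)))).
Proof.
have Q0 : 0 < Q by move: eW; case: (Q).
(* Step counts of what remains to be run, from the window loop back to the squaring loop. *)
pose t1 := (0 + (4 * n + 10 * kk + 40) * Wm.+1 + (10 * kk + 20) * n).+3.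
pose t2 := (t1 + 3 * Wm.+1).+2; pose t3 := (t2 + 3 * n).+2; pose t4 := (t3 + 3 * n).+2.
pose t5 := (t4 + 3 * (kk + Wm.+1)).+3; pose t6 := (t5 + 3 * n).+3.
(* The term [10 kk W] is quadratic in [kk]; since [kk <= n], it is at most [10 Q n kk]. *)
apply: (@lower_leq _ _ _ _ _ _ t6.+3); first by rewrite /t6 /t5 /t4 /t3 /t2 /t1 eW; nia.
set X := avgseq _ _ _.
have main m : m 0 = n -> m 1 = kk -> m 3 = 0 ->
  low t6.+1 (Config (behead (secretary Q B L)) m (fun=> 0%R) [::] a set0) X.
  move=> m0 m1 m3; next; rewrite /t6; rewrite m1 kk0.
  do 2 next; mem; rewrite neval_mul /= m1 -eW.
  apply: (@lower_square _ _ _ _ _ _ _ n 0); [by mem|by mem|].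
  move=> m2 hm2; mem; rewrite m3 m0 add0n => h3.
  rewrite /t5; do 2 next; mem; rewrite neval_mul /= h3 -eK.
  apply: (@lower_fill_cells _ _ _ _ _ _ _ (kk + Wm.+1) 0).
  - by mem; rewrite !hm2 //; mem; rewrite m1.
  - by mem.
  move=> m4 hm4 hm4c.
  have {}hm4c j : j < kk + Wm.+1 -> m4 (30 + j) = n.
    by move=> hj; have := hm4c j hj; rewrite addn0 => ->; mem; rewrite hm2 //; mem.
  have e0 : m4 0 = n by rewrite hm4 //; mem; rewrite hm2 //; mem.
  have e1 : m4 1 = kk by rewrite hm4 //; mem; rewrite hm2 //; mem.
  have e2 : m4 2 = Wm.+1 by rewrite hm4 //; mem; rewrite hm2 //; mem.
  have e3 : m4 3 = Km.+1 by rewrite hm4 //; mem.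
  rewrite /t4; next; apply: (@lower_fill_loop _ _ _ _ _ _ draw (reg 2) (reg 0) (30 + kk + Wm.+1) n _ _ _ 0).
  - by lia.
  - by move=> m' hm' /=; rewrite (hm' 0) // (hm' 1) // (hm' 2) //; mem; rewrite e0 e1 e2.
  - by [].
  - by mem.
  move=> d sd dW m5 hm5 hd; rewrite addn0 in hm5 hd.
  have {}hm5 b : b != 4 -> (b < 30 + kk + Wm.+1) || (30 + kk + Wm.+1 + n <= b) -> m5 b = m4 b.
    by move=> b4 hb; rewrite hm5 //; move/eqP: b4 => ?; mem.
  rewrite /t3; next; apply: (@lower_fill_loop _ _ _ _ _ _ tiekey (reg 3) (reg 0) (30 + kk + Wm.+1 + n) n _ _ _ 0).
  - by lia.
  - move=> m' hm' /=; rewrite (hm' 0) // (hm' 1) // (hm' 2) // (hm' 3) //; mem.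
    by rewrite !hm5 ?e0 ?e1 ?e2 ?e3 //; lia.
  - by [].
  - by mem.
  move=> v sv vK m6 hm6 hv; rewrite addn0 in hm6 hv.
  have {}hm6 b : b != 4 -> (b < 30 + kk + Wm.+1 + n) || (30 + kk + Wm.+1 + n + n <= b) -> m6 b = m5 b.
    by move=> b4 hb; rewrite hm6 //; move/eqP: b4 => ?; mem.
  rewrite /t2; next; apply: (@lower_fill_loop _ _ _ _ _ _ slot (reg 2) (reg 2) (30 + kk + Wm.+1 + n + n) Wm.+1 _ _ _ 0).
  - by lia.
  - move=> m' hm' /=; rewrite (hm' 0) // (hm' 1) // (hm' 2) //; mem.
    by rewrite !hm6 ?hm5 ?e0 ?e1 ?e2 //; lia.
  - by [].
  - by mem.
  move=> rv srv rvW m7 hm7 hr; rewrite addn0 in hm7 hr.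
  have {}hm7 b : b != 4 -> (b < 30 + kk + Wm.+1 + n + n) || (30 + kk + Wm.+1 + n + n + Wm.+1 <= b) -> m7 b = m6 b.
    by move=> b4 hb; rewrite hm7 //; move/eqP: b4 => ?; mem.
  rewrite /t1; do 2 next.
  have sc := sumn_counts sd dW.
  apply: (@lower_process_windows _ _ _ _ _ _ _ kk Wm Km.+1 B L d v rv ua fM kk0 (ltn0Sn _) sd dW vK srv rvW
    0 Wm.+1 0 [::] _ _ [::] a).
  - by [].
  - by [].
  - by rewrite drop0 reshapeKr // sc.
  - split.
    + by split; mem; rewrite hm7 ?hm6 ?hm5 //; lia.
    + split; first by rewrite size_nseq.
      move=> c ck; mem; rewrite hm7 ?hm6 ?hm5; try lia.
      by rewrite hm4c; [rewrite nth_nseq ck /denotes onth0n leqnn orbT|lia].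
    + move=> w wW; mem; rewrite hm7 ?hm6 ?hm5; try lia.
      rewrite -addnA hm4c; last by lia.
      by rewrite nth_nil /denotes onth0n leqnn orbT.
    + split=> j jn; mem; first by rewrite hm7 ?hm6; [exact: hd|lia..].
      by rewrite hm7; [exact: hv|lia..].
    + by move=> w wW; mem; exact: hr.
  - by mem.
  - by mem.
  move=> m' r' arr' pend'; apply: lower_halt => //.
    by apply: hP; exact: card_shortset.
  apply: le_trans (hg _); apply: best_value_ge; first exact: subsetIr.
  have [] := state_ok (U := [set: E]) M fM kk0 (nth 0 rv) (keys_bound a (ltn0Sn Km) vK) Wm.+1
    (zs := prog_windows Wm a d) (fun _ _ _ => in_setT _).
  by move=> _ iS _ _ _; apply: indepS iS; exact: subsetIl.
rewrite /start; next.
case: leqP => hn.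
  by next; mem; apply: main; mem; rewrite ?(minn_idPl hn).
by apply: (@lower_leq _ _ _ _ _ _ t6.+1) => //; apply: main; rewrite //= (minn_idPr (ltnW hn)).
Qed.

End Secretary.

Lemma lower_secretary_trivial (R : realType) (E : finType) (M : matroid E) (f : {set E} -> R)
    (P : config R E -> bool) (g : config R E -> R) (a : seq E) Q B L x :
  minn (size a) (rank M) = 0%N -> (forall c, shortlist c = set0 -> P c /\ x <= g c) ->
  lower M f P g 4 (start R M (secretary Q B L) a) x.
Proof.
move=> hk h.
have main m : m 1%N = 0%N ->
    lower M f P g 1 (Config (behead (secretary Q B L)) m (fun=> 0) [::] a set0) x.
  move=> m1; next; rewrite m1 /=.
  by have [hP hg] := h (Config [::] m (fun=> 0) [::] a set0) erefl; apply: lower_halt.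
rewrite /start; next; case: leqP => hn.
  apply: (@lower_leq _ _ _ _ _ _ 2) => //; next; apply: main; mem.
  by rewrite -hk (minn_idPl hn).
by apply: (@lower_leq _ _ _ _ _ _ 1) => //; apply: main; rewrite /= -hk (minn_idPr (ltnW hn)).
Qed.

Lemma rank_ge (E : finType) (M : matroid E) (A : {set E}) : M A -> (#|A| <= rank M)%N.
Proof. by move=> iA; apply: (@leq_bigmax_cond _ _ (fun S : {set E} => #|S|) A). Qed.

Lemma ALG_pavg (R : realType) (E : finType) (M : matroid E) (f : {set E} -> R) U p T :
  ALG M f U p T =
  pavg (enum U) (fun s => expected M f T (fun c => best_value M f (shortlist c)) (start R M p s)).
Proof. by []. Qed.

(** * Choice of the parameters *)

(** The least power of two that reaches [10 / eps] is less than twice that number; the 10 is the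
    constant of [total_value]. *)
Lemma power_of_two_between (R : realType) (eps : R) : 0 < eps -> eps < 1 ->
  exists q : nat, [/\ (8 <= 2 ^ q)%N, 10 / (2 ^ q)%:R <= eps & (2 ^ q)%:R <= 20 / eps].
Proof.
move=> e0 e1.
have ex : exists q, 10 / eps <= (2 ^ q)%:R.
  exists (Num.Def.archi_bound (10 / eps)); apply: le_trans (ltW (archi_boundP _)) _.
    by rewrite divr_ge0 // ltW.
  by rewrite ler_nat ltnW // ltn_expl.
case: (ex_minnP ex) => q hq qmin; exists q.
have h10 : 10 < 10 / eps by rewrite ltr_pdivlMr // gtr_pMr.
have q8 : (10 < 2 ^ q)%N by rewrite -(ltr_nat R); exact: lt_le_trans hq.
split; first by lia.
  rewrite ler_pdivrMr ?ltr0n ?expn_gt0 // mulrC -ler_pdivrMr //.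
case: q hq qmin q8 => [|q] hq qmin q8 //.
have lt : (2 ^ q)%:R < 10 / eps.
  by rewrite ltNge; apply/negP => /qmin; rewrite ltnn.
by rewrite expnS natrM; move: lt; move: (2 ^ q)%:R => t; lra.
Qed.

(** Since [expR (1 / 2) <= 2], one has [expR (q / 2) <= 2 ^ q <= 20 / eps <= expR (20 + l)], hence
    [q <= 40 + 2 l]. *)
Lemma log_bound (R : realType) (eps : R) (q : nat) : 0 < eps -> (2 ^ q)%:R <= 20 / eps ->
  q.+1%:R <= 41 * (1 + ln (1 + eps^-1)).
Proof.
move=> e0 hq; have i0 : 0 < eps^-1 by rewrite invr_gt0.
set l := ln _; have l0 : 0 <= l by rewrite ln_ge0 // lerDl ltW.
have half : expR (2^-1 : R) <= 2.
  have h : 2^-1 <= expR (- 2^-1 : R) by apply: le_trans (expR_ge1Dx _); lra.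
  by rewrite expRN lef_pV2 ?posrE ?expR_gt0 in h.
have h1 : expR (q%:R * 2^-1) <= (2 ^ q)%:R :> R.
  by rewrite expRM_natl natrX lerXn2r ?nnegrE ?expR_ge0.
have h2 : 20 / eps <= expR (20 + l).
  rewrite expRD lnK ?posrE ?addr_gt0 //.
  have : 1 + 20 <= expR 20 :> R by exact: expR_ge1Dx.
  by move: (expR 20) => t ht; nra.
have : q%:R * 2^-1 <= 20 + l by rewrite -ler_expR (le_trans h1) // (le_trans hq).
rewrite -[q.+1%:R]natr1; lra.
Qed.

Theorem theorem2 (R : realType) :
  exists (C : R) (d : nat), forall eps : R, 0 < eps ->
  exists (p : program) (D : nat),
    achieves p
      (2^-1 * (1 - (expR 2)^-1 - eps))
      (fun k => C * (k%:R / eps) * (1 + ln (1 + eps^-1)) ^+ d)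
      (fun n k => (D * (maxn 1 n * maxn 1 k))%N).
Proof.
(* The shortlist has at most [W L = Q kk 2 (q + 1)] items, where [Q <= 20 / eps] and
   [q + 1 <= 41 (1 + ln (1 + 1 / eps))]. *)
pose C : R := 20 * 82; have C0 : 0 <= C by rewrite mulr_ge0 ?ler0n.
exists C, 1%N => eps e0.
have i0 : 0 < eps^-1 by rewrite invr_gt0.
have l0 : 0 <= ln (1 + eps^-1) by rewrite ln_ge0 // lerDl ltW.
have eta0 k : 0 <= C * (k%:R / eps) * (1 + ln (1 + eps^-1)) ^+ 1.
  by rewrite expr1 mulr_ge0 ?addr_ge0 // mulr_ge0 // divr_ge0 ?ler0n // ltW.
have x2 : 0 < (expR 2 : R)^-1 by rewrite invr_gt0 expR_gt0.
(* For [eps >= 1] the required ratio is negative, and the empty program suffices. *)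
have [e1|e1] := leP 1 eps.
  exists [::], 0%N => E M f U f0 fM fS /=; split.
    by move=> s _; rewrite ?mul0n /= cards0 eta0.
  rewrite ALG_pavg ?mul0n /=; apply: (@le_trans _ _ 0).
    by rewrite mulr_le0_ge0 ?best_value_ge0 //; nra.
  by rewrite -[leLHS](pavg_const (enum U)); apply: pavg_le => s _; exact: best_value_ge0.
have [q [Q8 hQ1 hQ2]] := power_of_two_between e0 e1.
pose Q := (2 ^ q)%N.
exists (secretary Q (2 * Q) (2 * q.+1)), (200 * Q)%N => E M f U f0 fM fS n k.
set T := (_ * _)%N.
pose P (c : config R E) := #|shortlist c|%:R <= C * (k%:R / eps) * (1 + ln (1 + eps^-1)) ^+ 1.
pose g (c : config R E) := best_value M f (shortlist c).
pose kk := minn n k.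
have perm_s s : perm_eq s (enum U) -> uniq s /\ size s = n.
  by move=> ps; rewrite (perm_uniq ps) enum_uniq (perm_size ps) -cardE.
have O0 := best_value_ge0 M f0 U.
(* The two [maxn] in the time bound leave room for the initial tests when there is nothing to
   select. *)
have T4 : (4 <= T)%N.
  suff: (4 * 1 * (1 * 1) <= T)%N by [].
  by rewrite /T !leq_mul ?leq_maxl // expn_gt0.
suff [X [hX hlow]] : exists X : seq E -> R,
    2^-1 * (1 - (expR 2)^-1 - eps) * OPT M f U <= pavg (enum U) X /\
    forall s, perm_eq s (enum U) ->
      lower M f P g T (start R M (secretary Q (2 * Q) (2 * q.+1)) s) (X s).
  split; first by move=> s; rewrite mem_permutations => /hlow /(_ T (leqnn _)) [].
  rewrite ALG_pavg; apply: le_trans hX _; apply: pavg_le => s /hlow /(_ T (leqnn _)) [_].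
  exact: le_trans.
(* With [kk = 0] the empty set is optimal, and an empty shortlist attains its value. *)
have [k0|kk0] := posnP kk.
  exists (fun=> f set0); split.
    rewrite pavg_const; have [O [OU iO hO]] := best_value_attained M f0 U.
    have OE : O = set0.
      apply/eqP; rewrite -cards_eq0 -leqn0 -k0 leq_min (rank_ge iO) andbT.
      exact: subset_leq_card.
    rewrite OE in hO; apply: le_trans hO; rewrite -[leRHS]mul1r ler_wpM2r //; lra.
  move=> s ps; have [us ss] := perm_s s ps.
  apply: (lower_leq T4); apply: lower_secretary_trivial; first by rewrite ss.
  move=> c sc; rewrite /P /g sc cards0 eta0; split=> //.
  exact: best_value_ge (sub0set _) (indep0 M).
have n0 : (0 < n)%N by move: kk0; rewrite /kk; case: (n) => //; rewrite min0n.
have QW : (0 < Q * kk)%N by rewrite muln_gt0 kk0 expn_gt0.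
have QK : (0 < Q * (n * n))%N by rewrite !muln_gt0 n0 expn_gt0.
pose Wm := (Q * kk).-1; pose Km := (Q * (n * n)).-1.
have eW : Wm.+1 = (Q * kk)%N by rewrite prednK.
have eK : Km.+1 = (Q * (n * n))%N by rewrite prednK.
exists (fun a => avgseq Wm n (fun d => avgseq Km n (fun v => avgseq Wm Wm.+1 (fun rv =>
   prog_value M f kk Km.+1 (2 * Q) (2 * q.+1) Wm a d v rv)))); split.
  apply: le_trans (total_value f0 fM fS Q8 kk0 eW _ _).
  - by rewrite ler_wpM2r // ler_wpM2l ?invr_ge0 // lerD2l lerN2.
  - by rewrite eK mulnn.
  - by move=> A AU iA; rewrite leq_min (rank_ge iA) andbT; exact: subset_leq_card.
move=> s ps; have [us ss] := perm_s s ps.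
have := @lower_secretary _ _ M f fM P g s Q (2 * Q) (2 * q.+1) Wm Km us.
rewrite ss -/k -/kk => hl.
apply: (@lower_leq _ _ _ _ _ _ (200 * Q * (n * kk))%N).
  rewrite /T leq_mul // leq_mul ?leq_maxr //; apply: leq_trans (leq_maxr _ _).
  exact: geq_minr.
apply: hl => //.
move=> c hc; rewrite /P expr1.
have kk_k : kk%:R <= k%:R :> R by rewrite ler_nat geq_minr.
have hq := log_bound e0 hQ2.
apply: (@le_trans _ _ (Wm.+1 * (2 * q.+1))%N%:R); first by rewrite ler_nat.
rewrite eW !natrM.
apply: (@le_trans _ _ ((20 / eps) * k%:R * (2 * (41 * (1 + ln (1 + eps^-1)))))).
  by rewrite !ler_pM ?mulr_ge0.
by rewrite le_eqVlt; apply/orP; left; apply/eqP; rewrite /C; ring.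
Qed.
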